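(* Let $I\subset\mathbb{R}$ be a bounded (nonempty, open) interval, and let $s\in(0,1)$ and $p>1$ be such that $sp=1$. Let $$\alpha^*:=\gamma_s^{\frac{s}{1-s}},\qquad \gamma_s:=8\,\Gamma(p+1)\sum_{k=0}^\infty\frac{1}{(1+2k)^p}.$$ Then for every Borel measurable function $f:[0,\infty)\to[0,\infty)$ with $\lim_{t\to+\infty}f(t)=\infty$, $$\sup_{u\in\tilde W^{s,p}_0(I),\ [u]_{W^{s,p}(\mathbb{R})}\le 1}\ \int_I f(|u|)\,e^{\alpha^*|u|^{\frac{1}{1-s}}}\,dx=\infty$$ and $$\sup_{u\in W^{s,p}(\mathbb{R}),\ \|u\|_{W^{s,p}(\mathbb{R})}\le 1}\ \int_{\mathbb{R}} f(|u|)\,\Phi\!\left(\alpha^*|u|^{\frac{1}{1-s}}\right)dx=\infty .$$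
   Context: Let $s\in(0,1)$, $p>1$ with $sp=1$. For a real-valued measurable $u$ on $\mathbb{R}$, the Gagliardo seminorm is $$[u]_{W^{s,p}(\mathbb{R})}:=\left(\int_{\mathbb{R}}\int_{\mathbb{R}}\frac{|u(x)-u(y)|^p}{|x-y|^2}\,dx\,dy\right)^{1/p},$$ the Sobolev-Slobodeckij space is $W^{s,p}(\mathbb{R}):=\{u\in L^p(\mathbb{R}) : [u]_{W^{s,p}(\mathbb{R})}<+\infty\}$, and its norm is $\|u\|_{W^{s,p}(\mathbb{R})}:=\left(\|u\|_{L^p(\mathbb{R})}^p+[u]_{W^{s,p}(\mathbb{R})}^p\right)^{1/p}$. For an open interval $I\subset\mathbb{R}$, $\tilde W^{s,p}_0(I)$ denotes the closure of $C^\infty_0(I)$ (smooth functions with compact support in $I$, extended by $0$ to $\mathbb{R}$) in $W^{s,p}(\mathbb{R})$ with respect to the norm $\|\cdot\|_{W^{s,p}(\mathbb{R})}$. The function $\Phi$ is $$\Phi(t):=e^t-\sum_{k=0}^{\lceil p-2\rceil}\frac{t^k}{k!},$$ where $\lceil p-2\rceil$ is the smallest integer greater than or equal to $p-2$. $\Gamma$ is the Euler Gamma function. Integrals of nonnegative functions are allowed to take the value $+\infty$. *)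

(* Defs.v *)
From HB Require Import structures.
From mathcomp Require Import all_boot all_order all_algebra.
From mathcomp Require Import all_classical all_reals all_analysis.

Set Implicit Arguments.
Unset Strict Implicit.
Unset Printing Implicit Defensive.
Import Order.TTheory GRing.Theory Num.Theory.
Import numFieldNormedType.Exports.
Local Open Scope classical_set_scope.
Local Open Scope ring_scope.

(* The kernel is |x - y|^-(1 + s p) with s p = 1, so s does not occur.
   On the diagonal, a null set, x / 0 = 0 makes the integrand vanish. *)
Definition gagliardo {R : realType} (p : R) (u : R -> R) : \bar R :=
  ((\int[lebesgue_measure]_y \int[lebesgue_measure]_x
      (`|u x - u y| `^ p / `|x - y| ^+ 2)%:E) `^ p^-1)%E.

(* Elements are Borel functions rather than a.e. classes; every class of
   Lebesgue measurable functions has a Borel representative. *)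
Definition sobolev {R : realType} (p : R) : set (R -> R) :=
  [set u | u \in Lfun lebesgue_measure p%:E /\ (gagliardo p u < +oo)%E].

Definition sobolev_norm {R : realType} (p : R) (u : R -> R) : \bar R :=
  (('N[lebesgue_measure]_(p%:E)[EFin \o u] `^ p + gagliardo p u `^ p)
     `^ p^-1)%E.

Definition Cinfty_c {R : realType} (I : set R) : set (R -> R) :=
  [set phi | (forall n x, derivable (derive1n n phi) x 1) /\
     let supp := closure [set x | phi x != 0] in
     compact supp /\ supp `<=` I].

Definition sobolev0 {R : realType} (p : R) (I : set R) : set (R -> R) :=
  [set u | sobolev p u /\ forall e : R, 0 < e ->
     exists2 phi, Cinfty_c I phi & (sobolev_norm p (u \- phi)%R < e%:E)%E].

Definition Gamma {R : realType} (x : R) : R :=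
  \int[lebesgue_measure]_(t in `]0, +oo[) (t `^ (x - 1) * expR (- t)).

Definition gamma_s {R : realType} (p : R) : R :=
  8 * Gamma (p + 1) * limn [series ((1 + 2 * k%:R) `^ p)^-1 : R]_k.

Definition alpha_star {R : realType} (s p : R) : R :=
  gamma_s p `^ (s / (1 - s)).

(* For p > 1 the ceiling is nonnegative, so the absolute value `|_|%N only
   converts it to nat. *)
Definition Phi {R : realType} (p t : R) : R :=
  expR t - \sum_(0 <= k < (`|Num.ceil (p - 2)|%N).+1) t ^+ k / k`!%:R.

(* Main.v *)
Require Import Defs.
From HB Require Import structures.
From mathcomp Require Import all_boot all_order all_algebra.
From mathcomp Require Import all_classical all_reals all_analysis.
From mathcomp Require Import measurable_realfun ring lra.
Import Order.TTheory GRing.Theory Num.Theory.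
Import numFieldNormedType.Exports.
Local Open Scope classical_set_scope.
Local Open Scope ring_scope.

(** The suprema are infinite along a smooth version of the Moser sequence.  For
    L > 0 let w be smooth and nondecreasing on the line, equal to 0 for a <= 0,
    equal to L for large a, and 1-Lipschitz, and put v(x) = w(- ln |x|).  The
    whole point is that the seminorm of v obeys, without any error term,

      [v]^p <= gamma_s * L.                                                (1)

    To see this, substitute x = y z in the double integral, which by symmetry
    may be restricted to |z| > 1 and doubled.  The increment D = v(y) - v(y z)
    satisfies 0 <= D <= ln |z|, hence D^p <= (ln |z|)^(p-1) D; and the integral
    of D / |y| over the line is at most 2 L ln |z|, because dilating the
    measure dy / |y| moves a mass L ln |z| across the plateau of v on each
    half-line.  What is left is 4 L times the integral over |z| > 1 of
    (ln |z|)^p / (z - 1)^2.  Folding z < 0 onto z > 0 turns the kernel into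
      (z - 1)^-2 + (z + 1)^-2 = 2 sum_k (2k+1) z^-(2k+2),
    and each term integrates to 2 Gamma(p+1) / (2k+1)^p, so the sum is
    gamma_s / 4.

    The L^p norm of v is bounded independently of L.  Therefore
      u(x) = v((x - c) / r) / (gamma_s L + C)^(1/p)
    has norm and seminorm at most 1 once C dominates the p-th power of the
    L^p norm of v((x - c) / r).  On its plateau, an interval of length
    comparable to e^-L, u has a constant value M for which
    alpha_star M^(1/(1-s)) >= L - O(1), thanks to the choice of alpha_star and
    to (1).  The exponential integral over the plateau is thus bounded below
    by a fixed positive constant, and the extra factor f(M) makes it unbounded
    since M tends to infinity with L.  The profile w is chosen smooth with
    transitions of bounded length, so u is itself a test function on the
    interval and no density argument is required; for the second supremum,
    Phi(t) >= e^t / 2 for large t.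

    The main steps are [profile_scaling_integral] (mass crossing the plateau),
    [reflected_kernel_integral_le] (series for the kernel),
    [profile_gagliardo_le] (inequality (1)), [profile_Lp_le] (uniform L^p
    bound), [alpha_star_exponent] and [concentrating_bumps]. *)

Set Implicit Arguments.
Unset Strict Implicit.

(** * Functions differentiable n times on an open set *)

(** The derivatives are the total functions [derive1 f], as in the definition of
    test functions, so that the closure properties below are plain inductions
    on n. *)
Fixpoint Ck {R : realType} (n : nat) (U : set R) (f : R -> R) : Prop :=
  if n is m.+1 then (forall x, U x -> derivable f x 1) /\ Ck m U (derive1 f)
  else True.

Lemma CkP {R : realType} (U : set R) (f : R -> R) :
  (forall n, Ck n U f) -> forall n x, U x -> derivable (derive1n n f) x 1.
Proof.
move=> + n; elim: n f => [|n IH] f sf x Ux; first by have [+ _] := sf 1%N; apply.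
by rewrite derive1Sn; apply: IH => // k; case: (sf k.+1).
Qed.

(** Derivatives are local, so on an open set agreement of the functions
    propagates to all derivatives. *)
Lemma Ck_ext {R : realType} n (U : set R) (f g : R -> R) :
  open U -> (forall x, U x -> f x = g x) -> Ck n U f -> Ck n U g.
Proof.
move=> oU; elim: n f g => [|n IH] f g //= fg [df cf].
have nfg x : U x -> {near x, f =1 g}.
  by move=> Ux; have := open_nbhs_nbhs (conj oU Ux); apply: filterS.
split=> [x Ux|]; first exact: near_eq_derivable (nfg x Ux) (df x Ux).
apply: IH cf => x Ux; rewrite !derive1E.
exact: near_eq_derive (nfg x Ux).
Qed.

(** The working form of the definition: a derivative known only on U may be
    used in place of [derive1 f]. *)
Lemma Ck_is_derive {R : realType} n (U : set R) (f g : R -> R) :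
  open U -> (forall x, U x -> is_derive x 1 f (g x)) -> Ck n U g ->
  Ck n.+1 U f.
Proof.
move=> oU fg cg; split=> [x /fg[]//|].
by apply: Ck_ext cg => // x /fg[_ <-]; rewrite derive1E.
Qed.

Lemma Ck_sub {R : realType} n (U V : set R) (f : R -> R) :
  V `<=` U -> Ck n U f -> Ck n V f.
Proof.
by move=> VU; elim: n f => //= n IH f [df cf]; split=> [x /VU/df|] //; exact: IH.
Qed.

Lemma Ck_pred {R : realType} n (U : set R) (f : R -> R) :
  Ck n.+1 U f -> Ck n U f.
Proof. by elim: n f => // n IH f [df] /IH. Qed.

Lemma Ck_setU {R : realType} n (U V : set R) (f : R -> R) :
  Ck n U f -> Ck n V f -> Ck n (U `|` V) f.
Proof.
elim: n f => // n IH f [dU cU] [dV cV]; split; last exact: IH.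
by move=> x [Ux|Vx]; [exact: dU|exact: dV].
Qed.

Lemma Ck_cst {R : realType} n (U : set R) (c : R) : open U -> Ck n U (cst c).
Proof.
move=> oU; elim: n c => // n IH c.
by apply: (@Ck_is_derive _ _ _ _ (cst 0)) => // x _; exact: is_derive_cst.
Qed.

Lemma Ck_id {R : realType} n (U : set R) : open U -> Ck n U (@idfun R).
Proof.
case: n => // n oU.
apply: (@Ck_is_derive _ _ _ _ (cst 1) oU); exact: Ck_cst.
Qed.

Lemma CkD {R : realType} n (U : set R) (f g : R -> R) : open U ->
  Ck n U f -> Ck n U g -> Ck n U (f \+ g).
Proof.
move=> oU; elim: n f g => // n IH f g [df cf] [dg cg].
apply: (@Ck_is_derive _ _ _ _ (derive1 f \+ derive1 g)) => //; last exact: IH.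
move=> x Ux; rewrite /= !derive1E.
by apply: is_deriveD; apply/derivableP; [exact: df|exact: dg].
Qed.

Lemma CkM {R : realType} n (U : set R) (f g : R -> R) : open U ->
  Ck n U f -> Ck n U g -> Ck n U (f \* g).
Proof.
move=> oU; elim: n f g => // n IH f g sf sg.
apply: (@Ck_is_derive _ _ _ _ ((f \* derive1 g) \+ (derive1 f \* g))) => //.
  move=> x Ux; rewrite /= !derive1E.
  have -> : f x * 'D_1 g x + 'D_1 f x * g x
    = f x *: 'D_1 g x + g x *: 'D_1 f x by rewrite [X in _ + X]mulrC.
  by apply: is_deriveM; apply/derivableP; [case: sf => + _; exact|case: sg => + _; exact].
apply: CkD => //; apply: IH.
- exact: Ck_pred.
- by case: sg.
- by case: sf.
- exact: Ck_pred.
Qed.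

Lemma CkZ {R : realType} n (U : set R) (c : R) (f : R -> R) : open U ->
  Ck n U f -> Ck n U (fun x => c * f x).
Proof. by move=> oU cf; apply: (CkM oU (Ck_cst n c oU) cf). Qed.

Lemma Ck_comp {R : realType} n (U V : set R) (f g : R -> R) :
  open U -> open V -> (forall x, U x -> V (g x)) ->
  Ck n V f -> Ck n U g -> Ck n U (f \o g).
Proof.
move=> oU oV gUV; elim: n f => // n IH f sf sg.
have dfg x : U x -> is_derive x 1 (f \o g) (((derive1 f \o g) \* derive1 g) x).
  move=> Ux; rewrite /= !derive1E; apply: is_derive1_comp; apply/derivableP.
    by case: sf => + _; apply; exact: gUV.
  by case: sg => + _; apply.
refine (Ck_is_derive oU dfg _); apply: CkM => //; last by case: sg.
by apply: IH; [case: sf|exact: Ck_pred].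
Qed.

(** The derivative of the inverse is again a polynomial in the inverse, which
    closes the induction. *)
Lemma Ck_inv {R : realType} n : Ck n [set x : R | 0 < x] (fun x => x^-1).
Proof.
have o0 : open [set x : R | 0 < x] by exact: open_gt.
elim: n => // n IH.
have dV (x : R) : 0 < x -> is_derive x 1 (fun y : R => y^-1) (-1 * (x^-1 * x^-1)).
  move=> x0; have -> : -1 * (x^-1 * x^-1) = - x ^- 2 *: 1.
    by rewrite /GRing.scale/= mulr1 mulN1r -invfM -expr2.
  by apply: is_deriveV; rewrite gt_eqF.
exact: (Ck_is_derive o0 dV (CkZ _ o0 (CkM o0 IH IH))).
Qed.

Lemma Ck_ln {R : realType} n : Ck n [set x : R | 0 < x] (@ln R).
Proof.
case: n => // n; apply: Ck_is_derive (@Ck_inv R n); exact: open_gt.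
Qed.

(** The family indexed by k is stable under differentiation, up to linear
    combinations; its member k = 0 is the classical flat function. *)
Definition flat_exp {R : realType} (k : nat) (a : R) : R :=
  if 0 < a then a ^- k * expR (- a^-1) else 0.

(** One term of the exponential series never exceeds its sum. *)
Lemma expRn_le {R : realType} (y : R) (n : nat) : 0 <= y ->
  y ^+ n * expR (- y) <= n`!%:R.
Proof.
move=> y0; rewrite expRN ler_pdivrMr ?expR_gt0//.
case: n => [|n]; first by rewrite expr0 fact0 mul1r -expR0 ler_expR.
have := expR_ge1Dxn n y0; rewrite -ler_pdivrMl ?ltr0n ?fact_gt0// mulrC.
by apply: le_trans; rewrite lerDr.
Qed.

(** The quadratic bound gives the derivative 0 at the origin, the only point
    where the two branches meet. *)
Lemma flat_exp_le {R : realType} k (a : R) :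
  `|flat_exp k a| <= (k.+2)`!%:R * a ^+ 2.
Proof.
rewrite /flat_exp; case: ltP => [a0|_]; last first.
  by rewrite normr0 mulr_ge0// sqr_ge0.
rewrite ger0_norm ?mulr_ge0 ?expR_ge0 ?invr_ge0 ?exprn_ge0 ?(ltW a0)//.
have a2 : 0 < a ^+ 2 by rewrite exprn_gt0.
rewrite -ler_pdivrMr//.
have := @expRn_le _ a^-1 k.+2; rewrite invr_ge0 (ltW a0) => /(_ isT).
by apply: le_trans; rewrite exprVn -[in leRHS]addn2 exprD [in leRHS]invfM [leRHS]mulrAC.
Qed.

Lemma near_is_derive1 {R : realType} (f g : R -> R) (a d : R) :
  (\near a, f a = g a) -> is_derive a 1 f d -> is_derive a 1 g d.
Proof. exact: near_eq_is_derive. Qed.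

Lemma is_derive_flat_exp {R : realType} k (a : R) :
  is_derive a 1 (flat_exp k) (flat_exp k.+2 a - k%:R * flat_exp k.+1 a).
Proof.
have [a0|a0|<-] := ltgtP 0 a.
- apply: (@near_is_derive1 _ (fun x => (x^-1) ^+ k * expR (- x^-1))).
    near=> x; rewrite /flat_exp exprVn; case: ltP => //.
    rewrite leNgt; suff -> : 0 < x by [].
    near: x; exact: lt_nbhsr.
  have ai : is_derive a 1 (fun x : R => x^-1) (- a ^- 2 *: 1).
    by apply: is_deriveV; rewrite gt_eqF.
  have H1 := @is_deriveX _ _ _ k _ _ _ ai.
  have H2 : is_derive a 1 (expR \o (fun x : R => - x^-1)) (expR (- a^-1) * (- (- a ^- 2 *: 1))).
    by apply: is_derive1_comp; apply: is_deriveN.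
  have -> : (fun x : R => x^-1 ^+ k * expR (- x^-1)) =
      (fun x : R => x^-1) ^+ k * (expR \o (fun x : R => - x^-1)).
    by apply/funext => x; rewrite !fctE.
  have H3 := is_deriveM H1 H2.
  apply: is_derive_eq H3 _; rewrite /flat_exp a0 /GRing.scale/= !fctE !mulr1.
  clear H1; case: k => [|k] /=.
    by rewrite expr0 !mul0r !mulr0 addr0 subr0 mul1r opprK mulrC.
  rewrite !exprVn -!exprVn -mulr_natl !exprS; ring.
- apply: (@near_is_derive1 _ (cst 0)).
    near=> x; rewrite /flat_exp; suff -> : (0 < x) = false by [].
    apply/negbTE; rewrite -leNgt ltW//; near: x; exact: lt_nbhsl.
  rewrite /flat_exp [0 < a]ltNge (ltW a0)/= mulr0 subr0; exact: is_derive_cst.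
rewrite /flat_exp ltxx mulr0 subr0.
have H : (fun h => h^-1 *: (((flat_exp k \o shift 0) (h *: 1)) - flat_exp k 0)) @ (0:R)^' --> (0:R).
  apply/cvgr0Pnorm_le => /= e e0.
  near=> h; rewrite /= /GRing.scale/= mulr1 addr0 [flat_exp k 0]/flat_exp ltxx subr0.
  have h0 : h != 0 by near: h; exact: nbhs_dnbhs_neq.
  rewrite normrM normfV ler_pdivrMl ?normr_gt0//.
  apply: (le_trans (flat_exp_le _ _)).
  rewrite -[h ^+ 2]ger0_norm ?sqr_ge0// normrX expr2 mulrA [leRHS]mulrC.
  rewrite ler_wpM2r// -ler_pdivlMl ?ltr0n ?fact_gt0//.
  near: h; apply: dnbhs0_le; rewrite mulr_gt0// invr_gt0 ltr0n fact_gt0//.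
by split; [apply/cvg_ex; exists 0|exact/cvg_lim].
Unshelve. all: by end_near. Qed.

Lemma Ck_flat_exp {R : realType} n k : Ck n [set: R] (flat_exp k).
Proof.
elim: n k => // n IH k.
apply: (@Ck_is_derive _ _ _ _
  (flat_exp k.+2 \+ (fun x => (- k%:R) * flat_exp k.+1 x))).
- exact: openT.
- by move=> x _ /=; rewrite mulNr; exact: is_derive_flat_exp.
- by apply: CkD (IH _) (CkZ _ _ (IH _)); exact: openT.
Qed.

(** * A smooth ramp and the smoothed truncated logarithm *)

(** The ramp a e^(-1/a): its slope (1 + 1/a) e^(-1/a) lies between 0 and 1, and
    it stays within 1 of the positive part of a. *)
Definition softpos {R : realType} (a : R) : R := a * flat_exp 0 a.

Lemma softpos_gt0E {R : realType} (a : R) : 0 < a ->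
  softpos a = a * expR (- a^-1).
Proof. by move=> a0; rewrite /softpos /flat_exp a0 expr0 invr1 mul1r. Qed.

Lemma softpos_le0 {R : realType} (a : R) : a <= 0 -> softpos a = 0.
Proof. by move=> a0; rewrite /softpos /flat_exp ltNge a0 mulr0. Qed.

Lemma softpos_ge0 {R : realType} (a : R) : 0 <= softpos a.
Proof.
have [a0|/softpos_le0->//] := ltP 0 a.
by rewrite softpos_gt0E// mulr_ge0 ?expR_ge0// ltW.
Qed.

Lemma Ck_softpos {R : realType} n : Ck n [set: R] softpos.
Proof. exact: (CkM openT (Ck_id n openT) (Ck_flat_exp n 0)). Qed.

Lemma softpos_mono {R : realType} : {homo @softpos R : a b / a <= b}.
Proof.
move=> a b ab; have [a0|/softpos_le0->] := ltP 0 a; last exact: softpos_ge0.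
have b0 := lt_le_trans a0 ab.
rewrite !softpos_gt0E//; apply: ler_pM; rewrite ?expR_ge0 ?(ltW a0)//.
by rewrite ler_expR lerN2 lef_pV2.
Qed.

Lemma softpos_ge {R : realType} (a : R) : a - 1 <= softpos a.
Proof.
have [a0|a0] := ltP 0 a; last first.
  by rewrite softpos_le0//; lra.
rewrite softpos_gt0E//; apply: (@le_trans _ _ (a * (1 - a^-1))).
  by rewrite mulrBr mulr1 mulfV ?gt_eqF.
by rewrite ler_pM2l// expR_ge1Dx.
Qed.

(** Convexity of the exponential between 0 and s. *)
Lemma expRM_chord {R : realType} (t s : R) : 0 <= t -> t <= 1 ->
  expR (t * s) <= 1 - t + t * expR s.
Proof.
move=> t0 t1.
have st : t \in `[0, 1]%R by rewrite in_itv/= t0 t1.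
have := @convex_expR R (@Itv01 R t t0 t1) s 0.
rewrite !convRE/= expR0 mulr0 addr0 mulr1.
by rewrite addrC.
Qed.

(** The slope bound in integrated form: a (1 - e^(-1/a)) is nondecreasing, by the
    chord inequality with t = a / b. *)
Lemma softpos_lip {R : realType} (a b : R) : a <= b ->
  softpos b - softpos a <= b - a.
Proof.
move=> ab; have [b0|b0] := ltP 0 b; last first.
  by rewrite !softpos_le0// ?(le_trans ab)//; lra.
have sb (c : R) : 0 < c -> softpos c <= c.
  move=> c0; rewrite softpos_gt0E// -[leRHS]mulr1 ler_pM2l// -expR0 ler_expR.
  by rewrite oppr_le0 invr_ge0 ltW.
have [a0|a0] := ltP 0 a; last first.
  by rewrite [softpos a]softpos_le0// subr0; have := sb _ b0; lra.
rewrite !softpos_gt0E//.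
have t0 : 0 <= a / b by rewrite divr_ge0// ltW.
have t1 : a / b <= 1 by rewrite ler_pdivrMr// mul1r.
have := expRM_chord (- a^-1) t0 t1.
have -> : a / b * - a^-1 = - b^-1 by rewrite mulrN mulrAC mulfV ?gt_eqF// mul1r.
rewrite -(ler_pM2l b0).
have -> : b * (1 - a / b + a / b * expR (- a^-1)) = b - a + a * expR (- a^-1).
  by field; rewrite gt_eqF.
lra.
Qed.

(** The ramp composed with its own reflection: a smooth, nondecreasing and
    1-Lipschitz truncation of a between 0 and [softpos N]. *)
Definition clamp {R : realType} (N a : R) : R :=
  softpos N - softpos (N - softpos a).

Lemma clamp_le0 {R : realType} (N a : R) : a <= 0 -> clamp N a = 0.
Proof. by move=> a0; rewrite /clamp (softpos_le0 a0) subr0 subrr. Qed.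

Lemma clamp_ge {R : realType} (N a : R) : N + 1 <= a -> clamp N a = softpos N.
Proof.
move=> a0; rewrite /clamp [softpos (_ - _)]softpos_le0 ?subr0//.
by have := softpos_ge a; lra.
Qed.

Lemma clamp_mono {R : realType} (N a b : R) : a <= b -> clamp N a <= clamp N b.
Proof.
move=> ab; apply: (lerB (lexx _)); apply: softpos_mono.
by apply: (lerB (lexx _)); exact: softpos_mono.
Qed.

Lemma clamp_lip {R : realType} (N a b : R) : a <= b ->
  clamp N b - clamp N a <= b - a.
Proof.
move=> ab; have sab := softpos_mono ab; have := softpos_lip ab.
have : N - softpos b <= N - softpos a by rewrite lerB.
move=> /softpos_lip; rewrite /clamp.
move: (softpos (N - softpos a)) (softpos (N - softpos b)) => A B.
by move: (softpos a) (softpos b) (softpos N) sab => C D E; lra.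
Qed.

Lemma clamp_ge0 {R : realType} (N a : R) : 0 <= clamp N a.
Proof. by rewrite subr_ge0 softpos_mono// gerBl softpos_ge0. Qed.

Lemma clamp_le {R : realType} (N a : R) : clamp N a <= softpos N.
Proof. by rewrite gerBl softpos_ge0. Qed.

(** A smooth Moser function.  The value at 0 is imposed because [ln 0] is 0. *)
Definition moser {R : realType} (N x : R) : R :=
  if x == 0 then softpos N else clamp N (- ln `|x|).

Lemma moserN {R : realType} (N x : R) : moser N (- x) = moser N x.
Proof. by rewrite /moser oppr_eq0 normrN. Qed.

Lemma moser_ge0 {R : realType} (N x : R) : 0 <= moser N x.
Proof. by rewrite /moser; case: ifP => _; [exact: softpos_ge0|exact: clamp_ge0]. Qed.

Lemma moser_le {R : realType} (N x : R) : moser N x <= softpos N.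
Proof. by rewrite /moser; case: ifP => _ //; exact: clamp_le. Qed.

Lemma moser_eq0 {R : realType} (N x : R) : 1 <= `|x| -> moser N x = 0.
Proof.
move=> x1; rewrite /moser; case: eqVneq x1 => [->|_ x1]; first by rewrite normr0 ler10.
by rewrite clamp_le0// oppr_le0 ln_ge0.
Qed.

Lemma moser_plateau {R : realType} (N x : R) : `|x| <= expR (- (N + 1)) ->
  moser N x = softpos N.
Proof.
move=> xN; rewrite /moser; case: eqVneq xN => // x0 xN.
rewrite clamp_ge// lerNr -(expRK (- (N + 1))) ler_ln// posrE ?normr_gt0//.
exact: expR_gt0.
Qed.

(** In the variable - ln |x| dilations become translations, so this is the
    monotonicity and the Lipschitz bound of the truncation. *)
Lemma moser_decr {R : realType} (N y z : R) : 0 < y -> 1 <= z ->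
  0 <= moser N y - moser N (y * z) <= ln z.
Proof.
move=> y0 z1; have z0 : 0 < z by exact: lt_le_trans z1.
have yz0 : 0 < y * z by rewrite mulr_gt0.
rewrite /moser !gt_eqF// !gtr0_norm// lnM// (opprD (ln y)).
have lz := ln_ge0 z1.
have h : - ln y - ln z <= - ln y by lra.
apply/andP; split; first by rewrite subr_ge0 clamp_mono.
by apply: (le_trans (clamp_lip _ h)); lra.
Qed.

Lemma Ck_clamp {R : realType} n (N : R) : Ck n [set: R] (clamp N).
Proof.
have h : Ck n [set: R] (fun a => N - softpos a).
  apply: (Ck_ext openT _ (CkD openT (Ck_cst n N openT)
    (CkZ (-1) openT (Ck_softpos n)))) => x _ /=.
  by rewrite mulN1r.
apply: (Ck_ext openT _ (CkD openT (Ck_cst n (softpos N) openT)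
  (CkZ (-1) openT (Ck_comp openT openT _ (Ck_softpos n) h)))) => x _ //=.
by rewrite mulN1r.
Qed.

(** The line is covered by the two open half-lines, where the function is a
    composition of smooth maps, and a ball around 0, where it is constant. *)
Lemma Ck_moser {R : realType} n (N : R) : Ck n [set: R] (moser N).
Proof.
have ogt : open [set x : R | 0 < x] by exact: open_gt.
have olt : open [set x : R | x < 0] by exact: open_lt.
have cN U : open U -> Ck n U (fun x : R => - x).
  move=> oU; apply: (Ck_ext oU _ (CkZ (-1) oU (Ck_id n oU))) => x _ /=.
  by rewrite mulN1r.
have h1 : Ck n [set x : R | 0 < x] (moser N).
  apply: (Ck_ext ogt _ (Ck_comp ogt openT _ (Ck_clamp n N)
    (Ck_comp ogt openT _ (cN _ openT) (@Ck_ln R n)))) => [x x0|//|//].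
  rewrite /comp /moser; have -> : (x == 0) = false by apply: gt_eqF.
  by have -> : `|x| = x by apply: gtr0_norm.
have h2 : Ck n [set x : R | x < 0] (moser N).
  apply: (Ck_ext olt _ (Ck_comp olt ogt _ h1 (cN _ olt))) => x /= x0.
    by rewrite moserN.
  by rewrite oppr_gt0.
have oball : open (ball (0 : R) (expR (- (N + 1)))).
  by apply: ball_open; exact: expR_gt0.
have h3 : Ck n (ball (0 : R) (expR (- (N + 1)))) (moser N).
  apply: (Ck_ext oball _ (Ck_cst n (softpos N) oball)) => x.
  rewrite -ball_normE/= sub0r normrN => /ltW x0.
  by rewrite moser_plateau.
apply: Ck_sub (Ck_setU (Ck_setU h1 h2) h3) => x _.
have [x0|x0|<-] := ltgtP 0 x; [by left; left|by left; right|right].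
by apply: ballxx; exact: expR_gt0.
Qed.

(** * Affine changes of variable in the Lebesgue integral *)

Lemma affine_preimage_itvoc_gt0 {R : realType} (a b c d : R) : 0 < a ->
  (fun x => a * x + b) @^-1` `]c, d]%classic =
  `](c - b) / a, (d - b) / a]%classic.
Proof.
move=> a0; apply/seteqP; split=> x /=; rewrite !in_itv/=;
  by rewrite ltr_pdivrMr// ler_pdivlMr// ltrBlDr lerBrDr mulrC.
Qed.

(** A negative factor exchanges the open and the closed endpoint. *)
Lemma affine_preimage_itvoc_lt0 {R : realType} (a b c d : R) : a < 0 ->
  (fun x => a * x + b) @^-1` `]c, d]%classic =
  `[(d - b) / a, (c - b) / a[%classic.
Proof.
move=> a0; apply/seteqP; split=> x /=; rewrite !in_itv/=;
  by rewrite ltr_ndivlMr// ler_ndivrMr// ltrBlDr lerBrDr mulrC andbC.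
Qed.

(** By uniqueness of Lebesgue measure: |a| times the image of Lebesgue measure
    under the affine map gives half-open intervals their length. *)
Lemma ge0_integral_affine {R : realType} (f : R -> \bar R) (a b : R) :
  a != 0 -> measurable_fun [set: R] f -> (forall x, 0 <= f x)%E ->
  (\int[lebesgue_measure]_x f x =
   `|a|%:E * \int[lebesgue_measure]_x f (a * x + b)%R)%E.
Proof.
move=> a0 mf f0.
pose phi : measurableTypeR R -> measurableTypeR R := fun x => a * x + b.
have mphi : measurable_fun setT phi.
  by apply: measurable_funD => //; exact: measurable_funM.
pose pf : {measure set (measurableTypeR R) -> \bar R} :=
  measure_function_pushforward__canonical__measure_function_Measure
    lebesgue_measure mphi.
pose k : {nonneg R} := NngNum (normr_ge0 a).
pose nu := mscale k pf.
have nuE (A : set (measurableTypeR R)) : measurable A -> lebesgue_measure A = nu A.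
  apply: lebesgue_measure_unique => _ [[c d]] _ <-.
  transitivity (`|a|%:E * lebesgue_measure (phi @^-1` `]c, d]%classic))%E;
    last by [].
  rewrite lebesgue_measure_itv/= lte_fin.
  have [a_gt0|a_lt0] : 0 < a \/ a < 0 by case: ltgtP a0 => //; [left|right].
    rewrite [phi @^-1` _](affine_preimage_itvoc_gt0 b c d a_gt0) lebesgue_measure_itv/= lte_fin.
    rewrite ltr_pM2r ?invr_gt0// ltrD2r; case: ifP => _; last by rewrite mule0.
    rewrite -!EFinB -EFinM gtr0_norm//; congr EFin; field.
    by rewrite gt_eqF.
  rewrite [phi @^-1` _](affine_preimage_itvoc_lt0 b c d a_lt0) lebesgue_measure_itv/= lte_fin.
  rewrite ltr_nM2r ?invr_lt0// ltrD2r; case: ifP => _; last by rewrite mule0.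
  rewrite -!EFinB -EFinM ltr0_norm//; congr EFin; field.
  by rewrite lt_eqF.
transitivity (\int[nu]_x f x)%E.
  by apply: eq_measure_integral => A mA _; exact: nuE.
rewrite ge0_integral_mscale//; congr (_ * _)%E.
by rewrite ge0_integral_pushforward// preimage_setT.
Qed.

(** * The Gamma integral and powers of the logarithm *)

Lemma ge0_integral_even_split {R : realType} (f : R -> \bar R) :
  measurable_fun [set: R] f -> (forall x, 0 <= f x)%E ->
  (\int[lebesgue_measure]_x f x =
   \int[lebesgue_measure]_(x in `]0%R, +oo[) (f x + f (- x)%R))%E.
Proof.
move=> mf f0.
have mfN : measurable_fun [set: R] (fun x => f (- x)).
  by apply: (measurableT_comp mf).
rewrite ge0_integralD//; last 2 first.
  - exact: measurable_funTS mf.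
  - exact: measurable_funTS mfN.
rewrite [X in (_ + X)%E]integral_itv_obnd_cbnd; last exact: measurable_funTS mfN.
rewrite (ge0_integration_by_substitution0 mfN)//.
under [X in (_ + X)%E]eq_integral do rewrite opprK.
rewrite -ge0_integral_setU//=.
- by rewrite setUC -itv_bndbnd_setU//= set_itvNyy.
- by rewrite setUC -itv_bndbnd_setU//= set_itvNyy.
- by apply/disj_setPS => x /= []; rewrite !in_itv/= andbT; case: ltP.
Qed.

(** Half of the exponential absorbs the power of t. *)
Lemma powR_expR_le {R : realType} (p t : R) : 0 <= p -> 0 <= t ->
  t `^ p * expR (- t) <=
  (1 + 2 ^+ (Num.truncn p).+1 * ((Num.truncn p).+1)`!%:R) * expR (- (t / 2)).
Proof.
move=> p0 t0; set n := (Num.truncn p).+1.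
have tp : t `^ p <= 1 + t ^+ n.
  have [t1|t1] := leP t 1.
    apply: (@le_trans _ _ 1); last by rewrite lerDl exprn_ge0.
    have -> : 1 = 1 `^ p :> R by rewrite powR1.
    by apply: ge0_ler_powR => //; rewrite nnegrE.
  apply: (@le_trans _ _ (t ^+ n)); last by rewrite lerDr.
  rewrite -powR_mulrn//; apply: ler_powR; first exact: ltW.
  exact/ltW/truncnS_gt.
have t20 : 0 <= t / 2 by rewrite divr_ge0.
have e1 : expR (- t) = expR (- (t / 2)) * expR (- (t / 2)).
  by rewrite -expRD; congr expR; field.
rewrite e1 mulrA ler_wpM2r ?expR_ge0//.
apply: (le_trans (ler_wpM2r (expR_ge0 _) tp)).
rewrite mulrDl mul1r lerD//; first by rewrite expR_le1 oppr_le0.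
have {1}-> : t = 2 * (t / 2) by field.
by rewrite exprMn -mulrA ler_wpM2l ?exprn_ge0//; exact: expRn_le.
Qed.

(** [Gamma] is a real number extracted from an extended one; the identity holds
    because the integral is finite, by comparison with an exponential law. *)
Lemma Gamma_integral {R : realType} (p : R) : 0 <= p ->
  (\int[lebesgue_measure]_(t in `]0%R, +oo[) (t `^ p * expR (- t))%:E =
   (Gamma (p + 1))%:E)%E.
Proof.
move=> p0.
have meas : measurable_fun [set: R] (fun t : R => t `^ p * expR (- t)).
  apply: measurable_funM; first exact: measurable_powR.
  by apply: measurableT_comp.
rewrite /Gamma addrK /Rintegral fineK// ge0_fin_numE; last first.
  by apply: integral_ge0 => t _; rewrite lee_fin mulr_ge0 ?powR_ge0 ?expR_ge0.
set C : R := (1 + 2 ^+ (Num.truncn p).+1 * ((Num.truncn p).+1)`!%:R) * 2.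
have C0 : 0 <= C by rewrite mulr_ge0// addr_ge0// mulr_ge0// exprn_ge0.
apply: (@le_lt_trans _ _
  (\int[lebesgue_measure]_(t in `]0%R, +oo[) (C * exponential_pdf 2^-1 t)%:E)%E).
  apply: ge0_le_integral => //.
  - by move=> t _; rewrite lee_fin mulr_ge0 ?powR_ge0 ?expR_ge0.
  - by apply/measurable_EFinP; exact: measurable_funTS meas.
  - apply/measurable_EFinP/measurable_funTS; apply: measurable_funM => //.
    exact: measurable_exponential_pdf.
  - move=> t; rewrite /= in_itv/= andbT => t0.
    rewrite lee_fin (le_trans (powR_expR_le p0 (ltW t0)))//.
    rewrite (exponential_pdfE _ (ltW t0)) /C -!mulrA ler_wpM2l//.
    by rewrite mulrA mulfV// mul1r mulrC mulNr.
under eq_integral do rewrite EFinM.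
rewrite ge0_integralZl_EFin//; last 2 first.
  - by move=> t _; rewrite lee_fin exponential_pdf_ge0.
  - by apply/measurable_EFinP/measurable_funTS; exact: measurable_exponential_pdf.
apply: (@le_lt_trans _ _ (C%:E * \int[lebesgue_measure]_t (exponential_pdf 2^-1 t)%:E)%E).
  apply: lee_wpmul2l; first by rewrite lee_fin.
  apply: ge0_subset_integral => //.
  - by apply/measurable_EFinP; exact: measurable_exponential_pdf.
  - by move=> t _; rewrite lee_fin exponential_pdf_ge0.
by rewrite integral_exponential_pdf// mule1 ltry.
Qed.

Lemma within_continuous_powR_expR {R : realType} (p : R) : 0 < p ->
  {within `[0, +oo[, continuous (fun t : R => t `^ p * expR (- t))}.
Proof.
move=> p0.
have cexp : continuous (fun t : R => expR (- t)).
  by move=> x; apply: continuous_comp; [exact: opp_continuous|exact: continuous_expR].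
apply/continuous_within_itvcyP; split.
  move=> x x0; apply: cvgM; last exact: cexp.
  by have /derivable1_diffP/differentiable_continuous := derivable_powR (v := 1) (x := p) x0.
rewrite powR0 ?gt_eqF// mul0r -[X in _ --> X](mul0r (expR (- 0))).
apply: cvgM; first exact: powR_cvg0.
exact: cvg_at_right_filter (cexp 0).
Qed.

(** The substitution t = m ln z reduces the integral to the Gamma function. *)
Lemma integral_ln_pow {R : realType} (p m : R) : 0 < p -> 0 < m ->
  (\int[lebesgue_measure]_(z in `]1%R, +oo[)
     (ln z `^ p * z `^ (- (m + 1)))%:E =
   (Gamma (p + 1) / m `^ (p + 1))%:E)%E.
Proof.
move=> p0 m0.
pose F (z : R) := m * ln z.
pose G (t : R) := t `^ p * expR (- t).
have dF (z : R) : 0 < z -> is_derive z 1 F (m / z).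
  move=> z0; have -> : m / z = m *: z^-1 by [].
  exact: is_deriveZ (is_derive1_ln z0).
have F'E (z : R) : 0 < z -> derive1 F z = m / z.
  by move=> z0; rewrite derive1E; have [_ ->] := dF z z0.
have in1 (z : R) : z \in `]1, +oo[ -> 0 < z.
  by rewrite in_itv/= andbT; apply: lt_trans.
have mG : measurable_fun [set: R] G.
  apply: measurable_funM; first exact: measurable_powR.
  by apply: measurableT_comp.
have H := @increasing_ge0_integration_by_substitutiony R F G 1.
have F1 : F 1 = 0 by rewrite /F ln1 mulr0.
have {}H : (\int[lebesgue_measure]_(x in `[0%R, +oo[) (G x)%:E =
  \int[lebesgue_measure]_(x in `[1%R, +oo[) (((G \o F) * derive1 F) x)%:E)%E.
  rewrite -F1; apply: H.
  - move=> x y; rewrite !in_itv/= !andbT => x1 y1 xy.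
    by rewrite /F ltr_pM2l// ltr_ln// posrE (lt_le_trans ltr01).
  - move=> x x1; have x0 := in1 _ x1.
    have : {for x, continuous (fun z : R => m / z)}.
      apply: cvgM; first exact: cvg_cst.
      by apply: cvgV; [rewrite gt_eqF|exact: cvg_id].
    have h : {near x, (fun z : R => m / z) =1 derive1 F}.
      by near=> z; rewrite F'E//; near: z; exact: lt_nbhsr.
    rewrite /prop_for /continuous_at -(F'E _ x0) => hc.
    by apply: cvg_trans hc; apply: near_eq_cvg.
  - apply/cvg_ex; exists (m / 1).
    have : (fun z : R => m / z) z @[z --> 1^'+] --> m / 1.
      apply: cvg_at_right_filter; apply: cvgM; first exact: cvg_cst.
      by apply: cvgV; [rewrite gt_eqF|exact: cvg_id].
    apply: cvg_trans; apply: near_eq_cvg; near=> z; rewrite F'E//.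
    by apply: lt_trans ltr01 _; near: z; exact: nbhs_right_gt.
  - apply/cvg_ex; exists 0.
    have : (fun z : R => m * z^-1) z @[z --> +oo] --> m * 0.
      apply: cvgM; first exact: cvg_cst.
      by apply/gtr0_cvgV0; [near=> z|exact: cvg_id].
    rewrite mulr0; apply: cvg_trans; apply: near_eq_cvg; near=> z; rewrite F'E//.
  - split.
      by move=> x x1; have [] := dF _ (in1 _ x1).
    apply: cvg_at_right_filter.
    by have [/derivable1_diffP/differentiable_continuous] := dF _ ltr01.
  - apply/cvgryPge => A; near=> z.
    rewrite /F -ler_pdivrMl// -ler_expR lnK ?posrE.
      by near: z; exact: nbhs_pinfty_ge.
    by near: z; exact: nbhs_pinfty_gt.
  - by rewrite F1; exact: within_continuous_powR_expR.
  - by move=> x _; rewrite mulr_ge0 ?powR_ge0 ?expR_ge0.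
rewrite -integral_itv_obnd_cbnd in H; last first.
  by apply/measurable_EFinP; exact: measurable_funTS.
have mI : measurable_fun [set: R] (fun z : R => ln z `^ p * z `^ (- (m + 1))).
  apply: measurable_funM; last exact: measurable_powR.
  by apply: (measurableT_comp (measurable_powR p)); exact: measurable_ln.
have mp0 : 0 < m `^ (p + 1) by rewrite powR_gt0.
have E (z : R) : z \in `]1%R, +oo[ ->
    ((G \o F) * derive1 F) z = m `^ (p + 1) * (ln z `^ p * z `^ (- (m + 1))).
  move=> z1; have z0 := in1 _ z1.
  have lz0 : 0 <= ln z by move: z1; rewrite in_itv/= andbT => /ltW/ln_ge0.
  transitivity (G (F z) * derive1 F z) => //.
  rewrite F'E// /G /F powRM ?(ltW m0)// powRD ?(gt_eqF m0) ?implybT//.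
  rewrite powRr1 ?(ltW m0)// opprD powRD ?(gt_eqF z0) ?implybT//.
  have -> : z `^ (- m) = expR (- (m * ln z)).
    by rewrite /powR (gt_eqF z0) mulNr.
  rewrite powR_inv1 ?(ltW z0)//.
  ring.
rewrite -integral_itv_obnd_cbnd in H; last first.
  apply/measurable_EFinP; apply: (eq_measurable_fun
    (fun z => m `^ (p + 1) * (ln z `^ p * z `^ (- (m + 1))))).
    by move=> z; rewrite inE => /E ->.
  by apply: measurable_funTS; apply: measurable_funM.
have {}H : ((Gamma (p + 1))%:E = (m `^ (p + 1))%:E *
    \int[lebesgue_measure]_(z in `]1%R, +oo[)
     (ln z `^ p * z `^ (- (m + 1)))%:E)%E.
  rewrite -ge0_integralZl_EFin ?ltW//; last 2 first.
    by move=> z _; rewrite lee_fin mulr_ge0 ?powR_ge0.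
    by apply/measurable_EFinP; exact: measurable_funTS.
  rewrite -(Gamma_integral (ltW p0)) H; apply: eq_integral => z; rewrite inE => z1.
  by rewrite E.
by rewrite EFinM H muleAC -EFinM mulfV ?gt_eqF// mul1e.
Unshelve. all: by end_near.
Qed.

(** * The kernel of the seminorm as a series over the odd integers *)

Definition odd_zeta_term {R : realType} (p : R) (k : nat) : R :=
  ((1 + 2 * k%:R) `^ p)^-1.

Lemma odd_zeta_term_ge0 {R : realType} (p : R) k : 0 <= odd_zeta_term p k.
Proof. by rewrite invr_ge0 powR_ge0. Qed.

(** The mean value estimate for x^(1-p) on an interval of length 2, in the form
    e^x >= 1 + x. *)
Lemma odd_zeta_term_telescope {R : realType} (p : R) k : 1 < p ->
  odd_zeta_term p k.+1 <= (2 * (p - 1))^-1 *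
    ((1 + 2 * k%:R) `^ (1 - p) - (1 + 2 * k.+1%:R) `^ (1 - p)).
Proof.
move=> p1; rewrite /odd_zeta_term.
set y := 1 + 2 * k%:R; have y1 : 1 <= y by rewrite lerDl mulr_ge0.
have -> : 1 + 2 * k.+1%:R = y + 2 by rewrite /y -natr1; ring.
have y0 : 0 < y by exact: lt_le_trans y1.
set x := y + 2; have x0 : 0 < x by rewrite addr_gt0.
have p10 : 0 < p - 1 by rewrite subr_gt0.
rewrite mulrC ler_pdivlMr ?mulr_gt0// mulrC.
have -> : (x `^ p)^-1 = x `^ (1 - p) / x.
  rewrite powRD ?(gt_eqF x0) ?implybT// powRr1 ?(ltW x0)// powRN.
  by rewrite mulrAC mulfV ?mul1r// gt_eqF.
have -> : y `^ (1 - p) = x `^ (1 - p) * (y / x) `^ (1 - p).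
  by rewrite -powRM ?(ltW x0) ?divr_ge0 ?(ltW y0) ?(ltW x0)// mulrCA mulfV ?gt_eqF// mulr1.
have ge : 1 + 2 * (p - 1) / x <= (y / x) `^ (1 - p).
  have yx : 0 < y / x by rewrite divr_gt0.
  rewrite /powR gt_eqF//; apply: le_trans (expR_ge1Dx _) _; rewrite ler_expR.
  have -> : y / x = 1 + - (2 / x) by rewrite /x; field; rewrite -/x gt_eqF.
  have h : -1 < - (2 / x).
    by rewrite ltrN2 ltr_pdivrMr// mul1r /x ltrDr.
  by have := ler_wpM2l (ltW p10) (le_ln1Dx h); lra.
have xp : 0 < x `^ (1 - p) by rewrite powR_gt0.
rewrite -[X in _ <= _ - X]mulr1 -mulrBr mulrCA ler_pM2l//.
by move: ge; lra.
Qed.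

Lemma cvg_odd_zeta {R : realType} (p : R) : 1 < p ->
  cvgn (series (odd_zeta_term p)).
Proof.
move=> p1; apply: nondecreasing_is_cvgn.
  by apply: nondecreasing_series => k _ _; exact: odd_zeta_term_ge0.
have p10 : 0 < p - 1 by rewrite subr_gt0.
have C0 : 0 < (2 * (p - 1))^-1 by rewrite invr_gt0 mulr_gt0.
have bnd n : series (odd_zeta_term p) n.+1 <= 1 + (2 * (p - 1))^-1 *
    (1 - (1 + 2 * n%:R) `^ (1 - p)).
  elim: n => [|n IH].
    by rewrite /series/= big_nat1 /odd_zeta_term mulr0 addr0 !powR1 invr1 subrr mulr0 addr0.
  rewrite seriesSr.
  apply: (le_trans (lerD IH (odd_zeta_term_telescope n p1))).
  by rewrite -addrA -mulrDr lerD2l ler_pM2l//; lra.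
exists (1 + (2 * (p - 1))^-1) => _ [n _ <-].
apply: (@le_trans _ _ (series (odd_zeta_term p) n.+1)).
  by rewrite seriesSr lerDl odd_zeta_term_ge0.
apply: (le_trans (bnd n)); rewrite lerD2l -[leRHS]mulr1 ler_pM2l//.
Qed.

Lemma sum_odd_geometric {R : realType} (q : R) n : q != 1 ->
  \sum_(0 <= k < n) 2 * (1 + 2 * k%:R) * q ^+ k.+1 =
  2 * q * ((1 + q) - q ^+ n * ((1 + 2 * n%:R) - (2 * n%:R - 1) * q)) / (1 - q) ^+ 2.
Proof.
move=> q1; have q10 : 1 - q != 0 by rewrite subr_eq0 eq_sym.
elim: n => [|n IH]; first by rewrite big_geq// expr0 !mulr0n mulr0; field.
rewrite big_nat_recr//= IH (exprS q n) -natr1; field.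
by [].
Qed.

(** The remainder of the closed form is of order n q^n; writing q = e^-s, it is
    O(1/n) since (s n)^2 q^n <= 2. *)
Lemma odd_geometric_remainder {R : realType} (q e : R) : 0 < q -> q < 1 -> 0 < e ->
  exists n, 2 * q * (1 + q) / (1 - q) ^+ 2 <=
    \sum_(0 <= k < n) 2 * (1 + 2 * k%:R) * q ^+ k.+1 + e.
Proof.
move=> q0 q1 e0.
have q10 : 0 < (1 - q) ^+ 2 by rewrite exprn_gt0// subr_gt0.
pose s := - ln q; have s0 : 0 < s by rewrite oppr_gt0 ln_lt0// q0 q1.
(* n > D makes the remainder, at most 12 / (s^2 n (1 - q)^2), smaller than e. *)
pose D := 12 / (s ^+ 2 * (1 - q) ^+ 2 * e).
have D0 : 0 < D by rewrite divr_gt0// mulr_gt0// mulr_gt0// exprn_gt0.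
pose n := (Num.truncn D).+1; exists n.
have nD : D < n%:R by exact: truncnS_gt.
have n0 : 0 < n%:R :> R by rewrite ltr0n.
have n1 : 1 <= n%:R :> R by rewrite ler1n.
clearbody n.
rewrite sum_odd_geometric ?lt_eqF//.
rewrite mulrBr mulrBl -addrA lerDl addrC subr_ge0.
rewrite ler_pdivrMr//.
have qn : s ^+ 2 * n%:R ^+ 2 * q ^+ n <= 2.
  have := @expRn_le R (s * n%:R) 2; rewrite mulr_ge0 ?(ltW s0)// => /(_ isT).
  rewrite exprMn /s; congr (_ * _ <= _).
  by rewrite -mulNr opprK mulrC expRM_natl lnK ?posrE.
have qn0 : 0 < q ^+ n by rewrite exprn_gt0.
have h1 : 2 * q * (q ^+ n * (1 + 2 * n%:R - (2 * n%:R - 1) * q)) <=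
    2 * (q ^+ n * (3 * n%:R)).
  rewrite -[2 * q * _]mulrA ler_pM2l//.
  apply: (@le_trans _ _ (1 * (q ^+ n * (1 + 2 * n%:R - (2 * n%:R - 1) * q)))).
    rewrite ler_wpM2r ?(ltW q1)// mulr_ge0 ?(ltW qn0)//.
    have : (2 * n%:R - 1) * q <= (2 * n%:R - 1) * 1 by rewrite ler_wpM2l ?(ltW q1)//; lra.
    by lra.
  rewrite mul1r ler_pM2l//.
  have : 0 <= (2 * n%:R - 1) * q by rewrite mulr_ge0 ?(ltW q0)//; lra.
  by lra.
apply: (le_trans h1).
have sn0 : 0 < s ^+ 2 * n%:R by rewrite mulr_gt0// exprn_gt0.
rewrite -(ler_pM2l sn0).
apply: (@le_trans _ _ 12).
  have -> : s ^+ 2 * n%:R * (2 * (q ^+ n * (3 * n%:R))) = 6 * (s ^+ 2 * n%:R ^+ 2 * q ^+ n) by ring.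
  by lra.
have den : 0 < s ^+ 2 * (1 - q) ^+ 2 * e.
  by rewrite mulr_gt0// mulr_gt0// exprn_gt0.
move: nD; rewrite /D ltr_pdivrMr// => /ltW.
by have -> : n%:R * (s ^+ 2 * (1 - q) ^+ 2 * e) = s ^+ 2 * n%:R * (e * (1 - q) ^+ 2)
  by ring.
Qed.

Lemma reflected_kernelE {R : realType} (z : R) : 1 < z ->
  (z - 1) ^- 2 + (z + 1) ^- 2 =
  2 * z ^- 2 * (1 + z ^- 2) / (1 - z ^- 2) ^+ 2.
Proof.
move=> z1; have z0 : 0 < z by exact: lt_trans z1.
have zm : z - 1 != 0 by rewrite subr_eq0 gt_eqF.
have zp : z + 1 != 0 by rewrite gt_eqF// addr_gt0.
have -> : 1 - z ^- 2 = (z - 1) * (z + 1) / z ^+ 2 by field; rewrite gt_eqF.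
by field; rewrite zm zp gt_eqF.
Qed.

(** The kernel is expanded in powers of z^-2 and integrated term by term; the
    inequality follows as soon as the partial sums come within any e > 0 of the
    kernel. *)
Lemma reflected_kernel_integral_le {R : realType} (p : R) : 1 < p ->
  (\int[lebesgue_measure]_(z in `]1%R, +oo[)
     (ln z `^ p * ((z - 1) ^- 2 + (z + 1) ^- 2))%:E <=
   (gamma_s p / 4)%:E)%E.
Proof.
move=> p1; have p0 : 0 < p by exact: lt_trans p1.
pose m k : R := 1 + 2 * k%:R.
have m0 k : 0 < m k by rewrite ltr_pwDl// mulr_ge0.
pose T k (z : R) := (2 * m k) * (ln z `^ p * z `^ (- (m k + 1))).
have mI k : measurable_fun [set: R] (fun z : R => ln z `^ p * z `^ (- (m k + 1))).
  apply: measurable_funM; last exact: measurable_powR.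
  by apply: (measurableT_comp (measurable_powR p)); exact: measurable_ln.
have mT k : measurable_fun [set: R] (T k) by apply: measurable_funM.
have T0 k z : 0 <= T k z.
  by rewrite /T mulr_ge0 ?mulr_ge0 ?powR_ge0 ?(ltW (m0 k)).
have TE k (z : R) : 1 < z -> T k z = ln z `^ p * (2 * m k * (z ^- 2) ^+ k.+1).
  move=> z1; have z0 : 0 <= z by rewrite ltW// (lt_trans ltr01).
  rewrite /T mulrCA; congr (_ * (_ * _)).
  have -> : m k + 1 = (2 * k.+1)%:R by rewrite /m natrM -natr1; ring.
  by rewrite powR_invn// exprM exprVn.
have mker : measurable_fun [set: R]
    (fun z : R => ln z `^ p * ((z - 1) ^- 2 + (z + 1) ^- 2)).
  have msq (c : R) : measurable_fun [set: R] (fun z : R => (z + c) ^- 2).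
    have -> : (fun z : R => (z + c) ^- 2) = (fun z : R => `|z + c| `^ (- 2%:R)).
      apply/funext => z; rewrite powR_invn//; congr (_^-1).
      by rewrite -normrX ger0_norm// sqr_ge0.
    apply: (measurableT_comp (measurable_powR _)).
    apply: (measurableT_comp (@normr_measurable R setT)).
    exact: measurable_funD.
  apply: measurable_funM; last by apply: measurable_funD; exact: msq.
  by apply: (measurableT_comp (measurable_powR p)); exact: measurable_ln.
apply: (@le_trans _ _ (\int[lebesgue_measure]_(z in `]1%R, +oo[)
    (\sum_(0 <= k <oo) (T k z)%:E))%E).
  apply: ge0_le_integral => //.
  - move=> z _; rewrite lee_fin mulr_ge0 ?powR_ge0// addr_ge0// invr_ge0 ?sqr_ge0//.
  - by apply/measurable_EFinP; exact: measurable_funTS.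
  - apply: measurable_funTS.
    apply: (@ge0_emeasurable_sum _ _ _ _ (fun k z => (T k z)%:E) xpredT).
      by move=> k z _ _; rewrite lee_fin.
    by move=> k _; apply/measurable_EFinP; exact: mT.
  - move=> z; rewrite /= in_itv/= andbT => z1; have z0 : 0 < z by exact: lt_trans z1.
    rewrite reflected_kernelE//; set W := ln z `^ p.
    have W0 : 0 <= W by rewrite powR_ge0.
    apply/lee_addgt0Pr => e e0.
    have e'0 : 0 < e / (W + 1) by rewrite divr_gt0// ltr_wpDl.
    have q0 : 0 < z ^- 2 by rewrite invr_gt0 exprn_gt0.
    have q1 : z ^- 2 < 1 by rewrite invf_lt1 ?exprn_gt0// expr_gt1// ltW.
    have [n hn] := odd_geometric_remainder q0 q1 e'0.
    apply: (@le_trans _ _ ((\sum_(0 <= k < n) (T k z)%:E) + e%:E)%E); last first.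
      by apply: leeD2r; apply: nneseries_lim_ge => k _ _; rewrite lee_fin.
    rewrite sumEFin -EFinD lee_fin.
    apply: (le_trans (ler_wpM2l W0 hn)); rewrite mulrDr lerD//.
      by rewrite mulr_sumr le_eqVlt; apply/orP; left; apply/eqP;
        apply: eq_bigr => k _; rewrite TE.
    by rewrite mulrCA ler_piMr ?(ltW e0)// ler_pdivrMr ?ltr_wpDl// mul1r lerDl.
have mTD k : measurable_fun (`]1%R, +oo[%classic : set R) (EFin \o T k).
  by apply/measurable_EFinP; exact: measurable_funTS (mT k).
have TD0 k (z : R) : (`]1%R, +oo[%classic : set R) z -> (0 <= (T k z)%:E)%E.
  by move=> _; rewrite lee_fin.
rewrite integral_nneseries; [|exact: measurable_itv|exact: mTD|exact: TD0].
rewrite (@eq_eseriesr _ _ (fun k => (2 * Gamma (p + 1) * odd_zeta_term p k)%:E)); last first.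
  move=> k _; under eq_integral do rewrite /T EFinM.
  rewrite ge0_integralZl_EFin; first last.
  - by rewrite mulr_ge0// ltW.
  - by apply/measurable_EFinP; exact: measurable_funTS (mI k).
  - by move=> z _; rewrite lee_fin mulr_ge0 ?powR_ge0.
  - exact: measurable_itv.
  rewrite integral_ln_pow// -EFinM; congr EFin.
  rewrite /odd_zeta_term -/(m k) powRD ?(gt_eqF (m0 k)) ?implybT// powRr1 ?(ltW (m0 k))//.
  by field; rewrite !gt_eqF ?powR_gt0.
have G0 : 0 <= Gamma (p + 1).
  rewrite -lee_fin -(Gamma_integral (ltW p0)); apply: integral_ge0 => t _.
  by rewrite lee_fin mulr_ge0 ?powR_ge0 ?expR_ge0.
apply: lime_le.
  by apply: is_cvg_nneseries => k _ _; rewrite lee_fin mulr_ge0 ?odd_zeta_term_ge0// mulr_ge0.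
apply: nearW => n; rewrite sumEFin lee_fin -mulr_sumr.
have -> : gamma_s p / 4 = 2 * Gamma (p + 1) * limn (series (odd_zeta_term p)).
  by rewrite /gamma_s -/(odd_zeta_term _); field.
rewrite ler_wpM2l ?mulr_ge0//.
apply: nondecreasing_cvgn_le; last exact: cvg_odd_zeta.
by apply: nondecreasing_series => k _ _; exact: odd_zeta_term_ge0.
Qed.

(** * Dilations of logarithmic profiles *)

(** The inverse is a product of measurable functions: x^-1 = x |x|^-2 holds even
    at 0. *)
Lemma measurable_invr {R : realType} :
  measurable_fun [set: R] (fun x : R => x^-1).
Proof.
have -> : (fun x : R => x^-1) = (fun x => x * `|x| `^ (- 2%:R)).
  apply/funext => x; rewrite powR_invn// -normrX ger0_norm ?sqr_ge0//.
  have [->|x0] := eqVneq x 0; first by rewrite invr0 mul0r.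
  by field.
apply: measurable_funM => //; apply: (measurableT_comp (measurable_powR _)).
exact: (@normr_measurable R setT).
Qed.

Lemma integral_inv {R : realType} (a b : R) : 0 < a -> a < b ->
  (\int[lebesgue_measure]_(y in `]a, b]) (y^-1)%:E = (ln b - ln a)%:E)%E.
Proof.
move=> a0 ab; have b0 : 0 < b by exact: lt_trans ab.
rewrite integral_itv_obnd_cbnd; last first.
  by apply/measurable_EFinP; exact: measurable_funTS measurable_invr.
have pos (x : R) : a <= x -> 0 < x by exact: lt_le_trans.
have cln (x : R) : a <= x -> {for x, continuous (@ln R)}.
  by move=> /pos; exact: continuous_ln.
rewrite EFinB; apply: continuous_FTC2 => //.
- apply: continuous_in_subspaceT => x; rewrite inE/= in_itv/= => /andP[ax _].
  by apply: cvgV; [rewrite gt_eqF ?pos|exact: cvg_id].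
- split.
  + by move=> x; rewrite in_itv/= => /andP[/ltW/pos x0 _]; have [] := is_derive1_ln x0.
  + exact/cvg_at_right_filter/cln.
  + exact/cvg_at_left_filter/cln/ltW.
- move=> x; rewrite in_itv/= => /andP[/ltW/pos x0 _].
  by rewrite derive1E; have [_ ->] := is_derive1_ln x0.
Qed.

(** What the estimates use of the Moser function: L is its height and d the
    radius of its plateau. *)
Record log_profile {R : realType} (L d : R) (v : R -> R) := LogProfile {
  profile_measurable : measurable_fun [set: R] v ;
  profile_even : forall x, v (- x) = v x ;
  profile_ge0 : forall x, 0 <= v x ;
  profile_le : forall x, v x <= L ;
  profile_out : forall x, 1 <= `|x| -> v x = 0 ;
  profile_radius : 0 < d < 1 ;
  profile_plateau : forall x, `|x| <= d -> v x = L ;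
  profile_decr : forall y z, 0 < y -> 1 <= z -> 0 <= v y - v (y * z) <= ln z }.

(** Both terms of the difference, integrated separately, diverge at 0.  On the
    interval from d / z to 1, which carries the whole difference, they converge;
    the change of variable y z -> y moves the second integral to the interval from
    d to z, and comparing the two leaves the part of the first between d / z and d,
    of mass at most L (ln d - ln (d / z)). *)
Lemma profile_scaling_integral {R : realType} (L d : R) (v : R -> R) (z : R) :
  log_profile L d v -> 1 < z ->
  (\int[lebesgue_measure]_(y in `]0%R, +oo[) ((v y - v (y * z)) / y)%:E
   <= (L * ln z)%:E)%E.
Proof.
move=> [mv ve v0 vL vout /andP[d0 d1] vd vdec] z1.
have z0 : 0 < z by exact: lt_trans z1.
have dz0 : 0 < d / z by rewrite divr_gt0.
have dzd : d / z < d by rewrite ltr_pdivrMr// ltr_pMr.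
have L0 : 0 <= L by exact: le_trans (v0 0) (vL 0).
have mvz : measurable_fun [set: R] (fun y => v (y * z)).
  by apply: (measurableT_comp mv); exact: measurable_funM.
have mvi : measurable_fun [set: R] (fun y => v y / y).
  by apply: measurable_funM => //; exact: measurable_invr.
have mvzi : measurable_fun [set: R] (fun y => v (y * z) / y).
  by apply: measurable_funM => //; exact: measurable_invr.
have mg : measurable_fun [set: R] (fun y => (v y - v (y * z)) / y).
  by apply: measurable_funM; [exact: measurable_funB|exact: measurable_invr].
pose A := (`]d / z, 1]%classic : set R).
have A0 y : A y -> 0 < y by rewrite /A/= in_itv/= => /andP[/(lt_trans dz0)].
have g0 y : 0 < y -> 0 <= (v y - v (y * z)) / y.
  by move=> y0; rewrite divr_ge0 ?(ltW y0)//; have /andP[] := vdec y z y0 (ltW z1).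
have vi0 y : 0 < y -> 0 <= v y / y by move=> y0; rewrite divr_ge0 ?(ltW y0).
have vzi0 y : 0 < y -> 0 <= v (y * z) / y by move=> y0; rewrite divr_ge0 ?(ltW y0).
have -> : (\int[lebesgue_measure]_(y in `]0%R, +oo[) ((v y - v (y * z)) / y)%:E =
    \int[lebesgue_measure]_(y in A) ((v y - v (y * z)) / y)%:E)%E.
  rewrite integral_mkcond [RHS]integral_mkcond; apply: eq_integral => y _.
  rewrite !patchE; case: ifPn => y0; case: ifPn => yA //.
    move: y0 yA; rewrite inE notin_setE /= in_itv/= andbT => y0 yA.
    have [yd|yd] := leP y (d / z).
      rewrite !vd ?subrr ?mul0r//.
        by rewrite gtr0_norm ?mulr_gt0// -ler_pdivlMr.
      by rewrite gtr0_norm// (le_trans yd)// ltW.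
    have y1 : 1 < y by rewrite ltNge; apply/negP => y1; apply: yA; rewrite /A/= in_itv/= yd.
    rewrite !vout ?subrr ?mul0r//.
      by rewrite gtr0_norm ?mulr_gt0// ltW// (lt_trans y1)// ltr_pMr.
    by rewrite gtr0_norm// ltW.
  by move: y0 yA; rewrite notin_setE inE /= in_itv/= andbT => y0 /A0.
have mA : measurable A by exact: measurable_itv.
set I := (X in (X <= _)%E).
pose J := (\int[lebesgue_measure]_(y in `]d, 1%R]) (v y / y)%:E)%E.
have E1 : (\int[lebesgue_measure]_(y in A) (v y / y)%:E =
  I + \int[lebesgue_measure]_(y in A) (v (y * z) / y)%:E)%E.
  rewrite /I -ge0_integralD//.
  - by apply: eq_integral => y _; rewrite -EFinD -mulrDl subrK.
  - by move=> y /A0/g0; rewrite lee_fin.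
  - by apply/measurable_EFinP; exact: measurable_funTS mg.
  - by move=> y /A0/vzi0; rewrite lee_fin.
  - by apply/measurable_EFinP; exact: measurable_funTS mvzi.
have E2 : (J <= \int[lebesgue_measure]_(y in A) (v (y * z) / y)%:E)%E.
  pose h : R -> \bar R := (fun y => (v y / y)%:E) \_ `]d, z].
  have mh : measurable_fun [set: R] h.
    apply/(measurable_restrictT (D := `]d, z]%classic)) => //.
    by apply/measurable_EFinP; exact: measurable_funTS mvi.
  have h0 y : (0 <= h y)%E.
    rewrite /h patchE; case: ifPn => //; rewrite inE /= in_itv/= => /andP[yd _].
    by rewrite lee_fin vi0// (lt_trans d0).
  have zn0 : z != 0 by rewrite gt_eqF.
  have := ge0_integral_affine 0 zn0 mh h0.
  have mhz : measurable_fun [set: R] (fun y => h (z * y + 0)).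
    by apply: (measurableT_comp mh); apply: measurable_funD => //; exact: measurable_funM.
  rewrite -ge0_integralZl_EFin//.
  rewrite /h -integral_mkcond (gtr0_norm z0) => HE.
  apply: (@le_trans _ _ (\int[lebesgue_measure]_(y in `]d, z]) (v y / y)%:E)%E).
    apply: ge0_subset_integral => //.
    - by apply/measurable_EFinP; exact: measurable_funTS mvi.
    - move=> y; rewrite /= in_itv/= => /andP[yd _].
      by rewrite lee_fin vi0// (lt_trans d0).
    - by apply: subset_itvl; rewrite bnd_simp ltW.
  rewrite HE [leRHS]integral_mkcond le_eqVlt; apply/orP; left; apply/eqP.
  apply: eq_integral => y _; rewrite !patchE addr0 [z * y]mulrC.
  have -> : (y * z \in `]d, z]%classic) = (y \in A).
    have e : (y * z <= z) = (y <= 1) by rewrite -{2}[z]mul1r ler_pM2r.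
    by apply/idP/idP; rewrite !inE /A /= !in_itv/= ltr_pdivrMr// e.
  case: ifPn => [|_]; last by rewrite mule0.
  rewrite inE => /A0 y0; rewrite -EFinM; congr EFin; field.
  by rewrite !gt_eqF.
have E3 : (\int[lebesgue_measure]_(y in A) (v y / y)%:E <= (L * ln z)%:E + J)%E.
  have sA : `]d / z, d] `|` `]d, 1] = A :> set R.
    by apply/esym; apply: itv_bndbnd_setU; rewrite bnd_simp ltW.
  rewrite -{1}sA ge0_integral_setU//; last 3 first.
  - by apply/measurable_EFinP; exact: measurable_funTS mvi.
  - by move=> y; rewrite sA => /A0/vi0; rewrite lee_fin.
  - apply/disj_setPS => y /= []; rewrite !in_itv/= => /andP[_ yd] /andP[dy _].
    by move: (lt_le_trans dy yd); rewrite ltxx.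
  apply: leeD2r.
  apply: (@le_trans _ _ (\int[lebesgue_measure]_(y in `](d / z)%R, d]) (L * y^-1)%:E)%E).
    have pos y : `]d / z, d]%classic y -> 0 < y.
      by rewrite /= in_itv/= => /andP[/(lt_trans dz0)].
    apply: ge0_le_integral => //.
    - by move=> y /pos/vi0; rewrite lee_fin.
    - by apply/measurable_EFinP; exact: measurable_funTS mvi.
    - apply/measurable_EFinP/measurable_funTS; apply: measurable_funM => //.
      exact: measurable_invr.
    - by move=> y /pos y0; rewrite lee_fin ler_wpM2r ?invr_ge0 ?(ltW y0).
  under eq_integral do rewrite EFinM.
  rewrite ge0_integralZl_EFin//; last 2 first.
  - by move=> y; rewrite /= in_itv/= => /andP[/(lt_trans dz0)/ltW y0 _]; rewrite lee_fin invr_ge0.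
  - by apply/measurable_EFinP; exact: measurable_funTS measurable_invr.
  rewrite integral_inv// -EFinM ln_div ?posrE//.
  by rewrite opprB addrCA subrr addr0.
have J0 : (0 <= J)%E.
  apply: integral_ge0 => y; rewrite /= in_itv/= => /andP[dy _].
  by rewrite lee_fin vi0// (lt_trans d0).
have Jfin : J \is a fin_num.
  rewrite ge0_fin_numE//.
  apply: (@le_lt_trans _ _ (\int[lebesgue_measure]_(y in `]d, 1%R]) (cst (L / d)%:E) y)%E).
    apply: ge0_le_integral => //.
    - move=> y; rewrite /= in_itv/= => /andP[dy _].
      by rewrite lee_fin vi0// (lt_trans d0).
    - by apply/measurable_EFinP; exact: measurable_funTS mvi.
    - move=> y; rewrite /= in_itv/= => /andP[dy _].
      have y0 : 0 < y by exact: lt_trans dy.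
      by rewrite lee_fin ler_pM ?invr_ge0 ?(ltW y0)// lef_pV2 ?posrE// ltW.
  rewrite integral_cst//= lebesgue_measure_itv/= lte_fin d1 -EFinD -EFinM.
  exact: ltry.
have : (I + J <= (L * ln z)%:E + J)%E.
  by apply: le_trans E3; rewrite E1 leeD2l.
by rewrite leeD2rE.
Qed.

(** * The seminorm of a logarithmic profile *)

(** The regions |a| < |b| and |b| < |a| are exchanged by the symmetry, and their
    common boundary contributes nothing. *)
Lemma ge0_integral2_symmetric {R : realType} (k : R * R -> \bar R) :
  measurable_fun [set: R * R] k -> (forall w, 0 <= k w)%E ->
  (forall a b, k (a, b) = k (b, a)) ->
  (forall a b, `|a| = `|b| -> k (a, b) = 0%E) ->
  (\int[lebesgue_measure]_a \int[lebesgue_measure]_b k (a, b) =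
   2%:E * \int[lebesgue_measure]_a \int[lebesgue_measure]_b
      (if (`|a| < `|b|)%R then k (a, b) else 0))%E.
Proof.
move=> mk k0 ksym kdiag.
pose k1 (w : R * R) : \bar R := if `|w.1| < `|w.2| then k w else 0%E.
pose k2 (w : R * R) : \bar R := if `|w.2| < `|w.1| then k w else 0%E.
have mn1 : measurable_fun [set: R * R] (fun w : R * R => `|w.1|).
  exact: (measurableT_comp (@normr_measurable R setT)).
have mn2 : measurable_fun [set: R * R] (fun w : R * R => `|w.2|).
  exact: (measurableT_comp (@normr_measurable R setT)).
have mk1 : measurable_fun [set: R * R] k1.
  by apply: measurable_fun_ifT => //; exact: measurable_fun_ltr.
have mk2 : measurable_fun [set: R * R] k2.
  by apply: measurable_fun_ifT => //; exact: measurable_fun_ltr.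
have k10 w : (0 <= k1 w)%E by rewrite /k1; case: ifP.
have k20 w : (0 <= k2 w)%E by rewrite /k2; case: ifP.
have kE w : k w = (k1 w + k2 w)%E.
  rewrite /k1 /k2; case: w => a b /=.
  by case: ltgtP => [||/kdiag->]; rewrite ?adde0 ?add0e.
have fub (h : R * R -> \bar R) : measurable_fun [set: R * R] h ->
    (forall w, 0 <= h w)%E ->
    (\int[lebesgue_measure \x lebesgue_measure]_w h w =
    \int[lebesgue_measure]_a \int[lebesgue_measure]_b h (a, b))%E.
  by move=> mh h0; exact: fubini_tonelli1.
have fub2 (h : R * R -> \bar R) : measurable_fun [set: R * R] h ->
    (forall w, 0 <= h w)%E ->
    (\int[lebesgue_measure \x lebesgue_measure]_w h w =
    \int[lebesgue_measure]_b \int[lebesgue_measure]_a h (a, b))%E.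
  by move=> mh h0; exact: fubini_tonelli2.
rewrite -(fub k)//.
under eq_integral do rewrite kE.
rewrite ge0_integralD//.
rewrite (fub k1)// (fub2 k2)// mule_natl mule2n; congr (_ + _)%E.
apply: eq_integral => a _; apply: eq_integral => b _.
by rewrite /k1 /k2 /=; case: ifP => // _; rewrite ksym.
Qed.

Lemma measurable_fun_div {R : realType} d (T : measurableType d) (f g : T -> R) :
  measurable_fun [set: T] f -> measurable_fun [set: T] g ->
  measurable_fun [set: T] (fun x => f x / g x).
Proof.
by move=> mf mg; apply: measurable_funM => //; exact: (measurableT_comp measurable_invr).
Qed.

Lemma measurable_fun_powR_cst {R : realType} d (T : measurableType d) (f : T -> R) p :
  measurable_fun [set: T] f -> measurable_fun [set: T] (fun x => f x `^ p).
Proof. by move=> mf; exact: (measurableT_comp (measurable_powR p)). Qed.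

Lemma measurable_fun_normr {R : realType} d (T : measurableType d) (f : T -> R) :
  measurable_fun [set: T] f -> measurable_fun [set: T] (fun x => `|f x|).
Proof. by move=> mf; exact: (measurableT_comp (@normr_measurable R setT)). Qed.

(** Both half-lines contribute equally, as v is even. *)
Lemma profile_dilation_integral {R : realType} (L d : R) (v : R -> R) (z : R) :
  log_profile L d v -> 1 < `|z| ->
  (\int[lebesgue_measure]_y (`|v y - v (y * z)| / `|y|)%:E
   <= (2 * (L * ln `|z|))%:E)%E.
Proof.
move=> lp z1; have [mv ve v0 vL vout dd vd vdec] := lp.
have mg : measurable_fun [set: R] (fun y => `|v y - v (y * z)| / `|y|).
  apply: measurable_fun_div; apply: measurable_fun_normr => //.
  apply: measurable_funB => //; apply: (measurableT_comp mv); exact: measurable_funM.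
rewrite ge0_integral_even_split; last 2 first.
- exact/measurable_EFinP.
- by move=> y; rewrite lee_fin divr_ge0.
have vz y : 0 < y -> v (y * z) = v (y * `|z|).
  by case: (ger0P z) => // _ _; rewrite mulrN ve.
have mgz : measurable_fun [set: R] (fun y => (v y - v (y * `|z|)) / y).
  apply: measurable_fun_div => //; apply: measurable_funB => //.
  by apply: (measurableT_comp mv); exact: measurable_funM.
apply: (@le_trans _ _ (\int[lebesgue_measure]_(y in `]0%R, +oo[)
    (2%:E * ((v y - v (y * `|z|)) / y)%:E))%E).
  rewrite le_eqVlt; apply/orP; left; apply/eqP; apply: eq_integral => y.
  rewrite inE /= in_itv/= andbT => y0.
  rewrite mulNr !ve normrN vz// (gtr0_norm y0).
  have /andP[g0 _] := vdec y `|z| y0 (ltW z1).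
  by rewrite (ger0_norm g0) -EFinD -EFinM; congr EFin; ring.
rewrite ge0_integralZl_EFin//; last 2 first.
- move=> y; rewrite /= in_itv/= andbT => y0; have /andP[g0 _] := vdec y `|z| y0 (ltW z1).
  by rewrite lee_fin divr_ge0// ltW.
- by apply/measurable_EFinP; exact: measurable_funTS mgz.
rewrite EFinM lee_wpmul2l ?lee_fin//.
exact: profile_scaling_integral lp z1.
Qed.

(** Inequality (1) of the opening comment.  After the exchange of integrals the
    factor supplied by [profile_dilation_integral] completes the power p of ln |z|. *)
Lemma profile_gagliardo_le {R : realType} (p L d : R) (v : R -> R) : 1 < p ->
  log_profile L d v ->
  (\int[lebesgue_measure]_y \int[lebesgue_measure]_x
      (`|v x - v y| `^ p / `|x - y| ^+ 2)%:E <= (gamma_s p * L)%:E)%E.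
Proof.
move=> p1 lp; have [mv ve v0 vL vout dd vd vdec] := lp.
have p0 : 0 < p by exact: lt_trans p1.
have L0 : 0 <= L by exact: le_trans (v0 0) (vL 0).
have vabs x : v `|x| = v x by case: (ger0P x).
pose kr (w : R * R) := `|v w.2 - v w.1| `^ p / `|w.2 - w.1| ^+ 2.
have mkr : measurable_fun [set: R * R] kr.
  apply: measurable_fun_div.
    apply: measurable_fun_powR_cst; apply: measurable_fun_normr.
    by apply: measurable_funB; exact: (measurableT_comp mv).
  by apply: measurable_funX; apply: measurable_fun_normr; exact: measurable_funB.
have kr0 w : 0 <= kr w by rewrite divr_ge0 ?powR_ge0.
have -> := ge0_integral2_symmetric (k := EFin \o kr).
- pose k1 (w : R * R) := if `|w.1| < `|w.2| then kr w else 0.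
  have mk1 : measurable_fun [set: R * R] k1.
    apply: measurable_fun_ifT => //.
    by apply: measurable_fun_ltr; exact: measurable_fun_normr.
  have k10 w : 0 <= k1 w by rewrite /k1; case: ifP.
  pose kap (z : R) := if 1 < `|z| then ln `|z| `^ (p - 1) * (z - 1) ^- 2 else 0.
  have mabs : measurable_fun [set: R] (fun z : R => `|z|).
    exact: measurable_fun_normr.
  have msq : measurable_fun [set: R] (fun z : R => (z - 1) ^- 2).
    apply: (measurableT_comp measurable_invr).
    by apply: measurable_funX; exact: measurable_funB.
  have mlq (q : R) : measurable_fun [set: R]
      (fun z : R => if 1 < `|z| then ln `|z| `^ q * (z - 1) ^- 2 else 0).
    apply: measurable_fun_ifT => //; first exact: measurable_fun_ltr.
    apply: measurable_funM => //; apply: measurable_fun_powR_cst.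
    exact: (measurableT_comp (@measurable_ln R)).
  have mkap : measurable_fun [set: R] kap by exact: mlq.
  have kap0 z : 0 <= kap z.
    by rewrite /kap; case: ifP => // _; rewrite mulr_ge0 ?powR_ge0// invr_ge0 sqr_ge0.
  pose H (w : R * R) := kap w.2 * (`|v w.1 - v (w.1 * w.2)| / `|w.1|).
  have mH : measurable_fun [set: R * R] H.
    apply: measurable_funM; first exact: (measurableT_comp mkap).
    apply: measurable_fun_div; apply: measurable_fun_normr => //.
    apply: measurable_funB; first exact: (measurableT_comp mv).
    by apply: (measurableT_comp mv); exact: measurable_funM.
  have H0 w : 0 <= H w by rewrite mulr_ge0// divr_ge0.
  (* The substitution b = a z followed by |D|^p <= (ln |z|)^(p-1) |D| for the
     increment D of v. *)
  have B (a : R) : a != 0 ->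
    (\int[lebesgue_measure]_b (k1 (a, b))%:E <= \int[lebesgue_measure]_z (H (a, z))%:E)%E.
    move=> a0; have mk1a : measurable_fun [set: R] (fun b => (k1 (a, b))%:E).
      by apply/measurable_EFinP; exact: (measurable_fun_pair2 a mk1).
    have k1a0 b : (0 <= (k1 (a, b))%:E)%E by rewrite lee_fin.
    rewrite (ge0_integral_affine 0 a0 mk1a k1a0).
    have mk1z : measurable_fun [set: R] (fun z => (k1 (a, a * z + 0))%:E).
      apply: (measurableT_comp mk1a).
      have maff : measurable_fun [set: R] (fun z : R => a * z + 0).
        by apply: measurable_funD => //; exact: measurable_funM.
      exact: maff.
    rewrite -ge0_integralZl_EFin//.
    apply: ge0_le_integral => //.
    - by move=> z _; rewrite lee_fin mulr_ge0.
    - exact: measurable_funeM.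
    - by apply/measurable_EFinP; exact: (measurable_fun_pair2 a mH).
    - move=> z _; rewrite addr0 -EFinM lee_fin /k1 /H /kap /kr /= normrM.
      have na0 : 0 < `|a| by rewrite normr_gt0.
      have -> : (`|a| < `|a| * `|z|) = (1 < `|z|).
        by rewrite -{1}[`|a|]mulr1 ltr_pM2l.
      case: ifPn => z1; last by rewrite mulr0 mul0r.
      have l0 : 0 < ln `|z| by rewrite ln_gt0.
      have DE : `|v a - v (a * z)| = v `|a| - v (`|a| * `|z|).
        rewrite -normrM !vabs ger0_norm// -(vabs a) -(vabs (a * z)) normrM.
        by have /andP[] := vdec _ _ na0 (ltW z1).
      have Dl : `|v a - v (a * z)| <= ln `|z|.
        by rewrite DE; have /andP[] := vdec _ _ na0 (ltW z1).
      rewrite [`|v (a * z) - _|]distrC; set D := `|v a - v (a * z)|.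
      have D0 : 0 <= D by exact: normr_ge0.
      have zn1 : z - 1 != 0.
        by rewrite subr_eq0; apply: contraTneq z1 => ->; rewrite normr1 ltxx.
      rewrite -mulr_powRB1//.
      have -> : `|a * z - a| ^+ 2 = `|a| ^+ 2 * (z - 1) ^+ 2.
        rewrite -{2}[a]mulr1 -mulrBr normrM exprMn; congr (_ * _).
        by rewrite -normrX ger0_norm// sqr_ge0.
      have -> : `|a| * (D * D `^ (p - 1) / (`|a| ^+ 2 * (z - 1) ^+ 2)) =
          D `^ (p - 1) * ((z - 1) ^- 2 * (D / `|a|)).
        by field; rewrite zn1 gt_eqF.
      rewrite -mulrA ler_wpM2r//.
        by rewrite mulr_ge0 ?invr_ge0 ?sqr_ge0// divr_ge0 ?(ltW na0).
      apply: ge0_ler_powR; rewrite ?nnegrE ?subr_ge0 ?(ltW p1) ?(ltW l0)//.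
  (* The factor ln |z| missing from kap is supplied by the integral in a. *)
  have C (z : R) : (\int[lebesgue_measure]_a (H (a, z))%:E <=
      (2 * L)%:E * (if (1 < `|z|)%R then ln `|z| `^ p * (z - 1) ^- 2 else 0)%:E)%E.
    rewrite /H/=; have [z1|z1] := boolP (1 < `|z|); last first.
      by under eq_integral do rewrite /kap (negbTE z1) mul0r; rewrite integral0 mule0.
    under eq_integral do rewrite EFinM.
    rewrite ge0_integralZl_EFin; first last.
    - exact: kap0.
    - apply/measurable_EFinP; apply: measurable_fun_div => //.
      apply: measurable_fun_normr; apply: measurable_funB => //.
      by apply: (measurableT_comp mv); exact: measurable_funM.
    - by move=> a _; rewrite lee_fin divr_ge0.
    - exact: measurableT.
    apply: (@le_trans _ _ ((kap z)%:E * (2 * (L * ln `|z|))%:E)%E).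
      by apply: lee_wpmul2l; [rewrite lee_fin|exact: (profile_dilation_integral lp z1)].
    rewrite -!EFinM lee_fin /kap z1 -(mulr_powRB1 (ltW (ln_gt0 z1)) p0).
    rewrite le_eqVlt; apply/orP; left; apply/eqP; ring.
  have D : (\int[lebesgue_measure]_z
     (if (1 < `|z|)%R then ln `|z| `^ p * (z - 1) ^- 2 else 0)%:E <= (gamma_s p / 4)%:E)%E.
    rewrite ge0_integral_even_split; last 2 first.
    - by apply/measurable_EFinP; exact: mlq.
    - move=> z; case: ifP => // _.
      by rewrite lee_fin mulr_ge0 ?powR_ge0// invr_ge0 sqr_ge0.
    apply: le_trans (reflected_kernel_integral_le p1).
    rewrite integral_mkcond [leRHS]integral_mkcond le_eqVlt; apply/orP; left; apply/eqP.
    apply: eq_integral => z _; rewrite !patchE.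
    case: (boolP (z \in `]0%R, +oo[%classic)) => z0;
    case: (boolP (z \in `]1%R, +oo[%classic)) => z1.
    - move: z0 z1; rewrite !inE/= !in_itv/= !andbT => z0 z1.
      rewrite normrN gtr0_norm// z1 -EFinD -mulrDr; congr (_ * (_ + _))%:E.
      by rewrite -opprD sqrrN.
    - move: z0 z1; rewrite inE notin_setE/= !in_itv/= !andbT => z0 z1.
      rewrite normrN gtr0_norm//; move/negP/negbTE: z1 => ->.
      by rewrite adde0.
    - move: z0 z1; rewrite inE notin_setE/= !in_itv/= !andbT => z0 z1.
      by exfalso; apply: z0; exact: lt_trans z1.
    - by [].
  have -> : (gamma_s p * L)%:E = (2%:E * ((2 * L)%:E * (gamma_s p / 4)%:E))%E.
    by rewrite -!EFinM; congr EFin; field.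
  apply: lee_wpmul2l; first by rewrite lee_fin.
  have mEk1 : measurable_fun [set: R * R] (EFin \o k1) by exact/measurable_EFinP.
  have mEH : measurable_fun [set: R * R] (EFin \o H) by exact/measurable_EFinP.
  apply: (@le_trans _ _ (\int[lebesgue_measure]_a \int[lebesgue_measure]_z (H (a, z))%:E)%E).
    have -> : (\int[lebesgue_measure]_a \int[lebesgue_measure]_b
         (if (`|a| < `|b|)%R then (EFin \o kr) (a, b) else 0))%E =
       (\int[lebesgue_measure]_a \int[lebesgue_measure]_b (k1 (a, b))%:E)%E.
      apply: eq_integral => a _; apply: eq_integral => b _.
      by rewrite /k1/=; case: ifP.
    (* a = 0 is excluded: the change of variable degenerates there. *)
    apply: ae_ge0_le_integral => //.
    - by move=> a _; apply: integral_ge0 => b _; rewrite lee_fin.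
    - by apply: (@measurable_fun_fubini_tonelli_F _ _ _ _ _ lebesgue_measure (EFin \o k1)) => // w; rewrite lee_fin.
    - by move=> a _; apply: integral_ge0 => b _; rewrite lee_fin.
    - by apply: (@measurable_fun_fubini_tonelli_F _ _ _ _ _ lebesgue_measure (EFin \o H)) => // w; rewrite lee_fin.
    - exists [set 0]; split => //; first exact: lebesgue_measure_set1.
      move=> a /=; apply: contra_notP => a0 _; apply: B.
      by apply/eqP => a1; apply: a0; rewrite a1.
  have -> : (\int[lebesgue_measure]_a \int[lebesgue_measure]_z (H (a, z))%:E =
     \int[lebesgue_measure]_z \int[lebesgue_measure]_a (H (a, z))%:E)%E.
    by apply: (@fubini_tonelli _ _ _ _ _ lebesgue_measure lebesgue_measure (EFin \o H)) => // w; rewrite lee_fin.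
  apply: le_trans (lee_wpmul2l _ D); last by rewrite lee_fin mulr_ge0.
  rewrite -ge0_integralZl_EFin; first last.
  - by rewrite mulr_ge0.
  - by apply/measurable_EFinP; exact: mlq.
  - move=> z _; rewrite lee_fin; case: ifP => // _.
    by rewrite mulr_ge0 ?powR_ge0// invr_ge0 sqr_ge0.
  - exact: measurableT.
  apply: ge0_le_integral => //.
  - by move=> z _; apply: integral_ge0 => a _; rewrite lee_fin.
  - by apply: (@measurable_fun_fubini_tonelli_G _ _ _ _ _ lebesgue_measure (EFin \o H)) => // w; rewrite lee_fin.
  - by apply: measurable_funeM; apply/measurable_EFinP; exact: mlq.
- exact/measurable_EFinP.
- by move=> w; rewrite lee_fin.
- by move=> a b; rewrite /kr/= distrC [`|b - a|]distrC.
- by move=> a b ab; rewrite /kr/= -(vabs a) -(vabs b) ab subrr normr0 powR0 ?gt_eqF// mul0r.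
Qed.

(** * The L^p norm of a logarithmic profile *)

Lemma powR_addn_le {R : realType} (p a b : R) : 0 <= p -> 0 <= a -> 0 <= b ->
  (a + b) `^ p <= 2 `^ p * a `^ p + 2 `^ p * b `^ p.
Proof.
move=> p0 a0 b0; wlog ab : a b a0 b0 / a <= b.
  move=> H; have [ab|/ltW ba] := leP a b; first exact: H.
  by rewrite addrC [leRHS]addrC; exact: H.
apply: (@le_trans _ _ (2 `^ p * b `^ p)).
  by rewrite -powRM//; apply: ge0_ler_powR; rewrite ?nnegrE ?addr_ge0 ?mulr_ge0//; lra.
by rewrite lerDr mulr_ge0 ?powR_ge0.
Qed.

(** Any bound depending on p alone would do; this one comes from dilating by
    2^(p+1). *)
Definition profile_Lp_const {R : realType} (p : R) : R :=
  2 * (2 `^ p * ln (2 `^ (p + 1)) `^ p * 2).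

Lemma profile_Lp_const_ge0 {R : realType} (p : R) : 0 <= profile_Lp_const p.
Proof. by rewrite /profile_Lp_const !mulr_ge0 ?powR_ge0. Qed.

(** With z = 2^(p+1), v(x) <= v(x z) + ln z on [-1, 1] gives
    v(x)^p <= 2^p v(x z)^p + const there.  Integrating, I <= 2^p I / z + const with
    2^p / z = 1/2, and I is finite, so it can be absorbed. *)
Lemma profile_Lp_le {R : realType} (p L d : R) (v : R -> R) : 0 < p ->
  log_profile L d v ->
  (\int[lebesgue_measure]_x (v x `^ p)%:E <= (profile_Lp_const p)%:E)%E.
Proof.
move=> p0 [mv ve v0 vL vout dd vd vdec].
have L0 : 0 <= L by exact: le_trans (v0 0) (vL 0).
set z : R := 2 `^ (p + 1).
have z1 : 1 <= z.
  have -> : 1 = 2 `^ 0 :> R by rewrite powRr0.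
  by apply: ler_powR; rewrite ?ler1n// addr_ge0// ltW.
have z0 : 0 < z by exact: lt_le_trans z1.
have lz := ln_ge0 z1.
pose c : R := 2 `^ p * ln z `^ p.
have c0 : 0 <= c by rewrite mulr_ge0 ?powR_ge0.
pose one : R -> R := \1_(`[-1, 1]%classic : set R).
have mone : measurable_fun [set: R] one by exact: measurable_indic.
have mvp : measurable_fun [set: R] (fun x => v x `^ p) by exact: measurable_fun_powR_cst.
have mvpz : measurable_fun [set: R] (fun x => v (x * z) `^ p).
  by apply: (measurableT_comp mvp); exact: measurable_funM.
have one0 x : 0 <= one x by [].
have oneE x : `|x| <= 1 -> one x = 1.
  by rewrite ler_norml => x1; rewrite /one indicE mem_set//= in_itv/= x1.
have intone : (\int[lebesgue_measure]_x (one x)%:E = 2%:E)%E.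
  rewrite /one integral_indic// setIT/= lebesgue_measure_itv/= lte_fin.
  by rewrite ifT ?gtrN// -EFinD opprK.
have vabs x : v `|x| = v x by case: (ger0P x).
have ptw x : v x `^ p <= 2 `^ p * v (x * z) `^ p + c * one x.
  have [x1|x1] := leP `|x| 1; last first.
    by rewrite vout ?(ltW x1)// powR0 ?gt_eqF// addr_ge0 ?mulr_ge0 ?powR_ge0.
  rewrite oneE// mulr1.
  have vz : v x <= v (x * z) + ln z.
    have [->|xn] := eqVneq x 0; first by rewrite mul0r lerDl.
    have xa : 0 < `|x| by rewrite normr_gt0.
    have /andP[_] := vdec _ _ xa z1.
    by rewrite -{1}(gtr0_norm z0) -normrM !vabs lerBlDl.
  apply: le_trans (powR_addn_le (ltW p0) (v0 _) lz).
  by apply: ge0_ler_powR; rewrite ?nnegrE ?addr_ge0// ltW.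
set I := (X in (X <= _)%E).
have I0 : (0 <= I)%E by apply: integral_ge0 => x _; rewrite lee_fin powR_ge0.
have Ifin : I \is a fin_num.
  rewrite ge0_fin_numE//.
  apply: (@le_lt_trans _ _ (\int[lebesgue_measure]_x ((L `^ p)%:E * (one x)%:E))%E).
    apply: ge0_le_integral => //.
    - by move=> x _; rewrite lee_fin powR_ge0.
    - exact/measurable_EFinP.
    - by apply: measurable_funeM; exact/measurable_EFinP.
    - move=> x _; rewrite -EFinM lee_fin.
      have [x1|x1] := leP `|x| 1; last first.
        by rewrite vout ?(ltW x1)// powR0 ?gt_eqF// mulr_ge0 ?powR_ge0.
      by rewrite oneE// mulr1; apply: ge0_ler_powR; rewrite ?nnegrE// ltW.
  rewrite ge0_integralZl_EFin; first last.
  - exact: powR_ge0.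
  - exact/measurable_EFinP.
  - by move=> x _; rewrite lee_fin.
  - exact: measurableT.
  by rewrite intone -EFinM ltry.
have Iz : (\int[lebesgue_measure]_x (v (x * z) `^ p)%:E = (z^-1)%:E * I)%E.
  have zn0 : z != 0 by rewrite gt_eqF.
  have mF : measurable_fun [set: R] (fun x => (v x `^ p)%:E) by exact/measurable_EFinP.
  have F0 x : (0 <= (v x `^ p)%:E)%E by rewrite lee_fin powR_ge0.
  rewrite /I (ge0_integral_affine 0 zn0 mF F0) muleA -EFinM gtr0_norm// mulVf// mul1e.
  by apply: eq_integral => x _; rewrite addr0 mulrC.
(* Here 2^p / z = 1/2. *)
have step : (I <= (2^-1)%:E * I + (c * 2)%:E)%E.
  apply: (@le_trans _ _ (\int[lebesgue_measure]_x
      ((2 `^ p)%:E * (v (x * z) `^ p)%:E + c%:E * (one x)%:E))%E).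
    apply: ge0_le_integral => //.
    - by move=> x _; rewrite lee_fin powR_ge0.
    - exact/measurable_EFinP.
    - by apply: emeasurable_funD; apply: measurable_funeM; exact/measurable_EFinP.
    - by move=> x _; rewrite -!EFinM -EFinD lee_fin.
  rewrite ge0_integralD; first last.
  - by apply: measurable_funeM; exact/measurable_EFinP.
  - by move=> x _; rewrite -EFinM lee_fin mulr_ge0.
  - by apply: measurable_funeM; exact/measurable_EFinP.
  - by move=> x _; rewrite -EFinM lee_fin mulr_ge0 ?powR_ge0.
  - exact: measurableT.
  rewrite ge0_integralZl_EFin; first last.
  - exact: powR_ge0.
  - exact/measurable_EFinP.
  - by move=> x _; rewrite lee_fin powR_ge0.
  - exact: measurableT.
  rewrite ge0_integralZl_EFin; first last.
  - exact: c0.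
  - exact/measurable_EFinP.
  - by move=> x _; rewrite lee_fin.
  - exact: measurableT.
  rewrite intone Iz muleA -!EFinM.
  have -> : 2 `^ p / z = 2^-1.
    by rewrite /z powRD ?pnatr_eq0 ?implybT// powRr1// invfM mulrA mulfV ?mul1r// gt_eqF// powR_gt0.
  exact: lexx.
move: step; rewrite -(fineK Ifin) -EFinM -EFinD !lee_fin.
by rewrite /profile_Lp_const -/z -/c; lra.
Qed.

Lemma moser_profile {R : realType} (N : R) : 0 <= N ->
  log_profile (softpos N) (expR (- (N + 1))) (moser N).
Proof.
move=> N0; split.
- apply: continuous_measurable_fun => x.
  have [+ _] := @Ck_moser R 1%N N => /(_ x I).
  by move/derivable1_diffP/differentiable_continuous.
- exact: moserN.
- exact: moser_ge0.
- exact: moser_le.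
- exact: moser_eq0.
- by rewrite expR_gt0/= expR_lt1; lra.
- exact: moser_plateau.
- by move=> y z y0 z1; exact: moser_decr.
Qed.

(** * Rescaled profiles and the norms of the space *)

Lemma Gamma_gt0 {R : realType} (p : R) : 0 <= p -> 0 < Gamma (p + 1).
Proof.
move=> p0; rewrite -lte_fin -(Gamma_integral p0).
have meas : measurable_fun [set: R] (fun t : R => t `^ p * expR (- t)).
  apply: measurable_funM; first exact: measurable_powR.
  by apply: measurableT_comp.
apply: (@lt_le_trans _ _ (\int[lebesgue_measure]_(t in `[1%R, 2%R]) (t `^ p * expR (- t))%:E)%E);
  last first.
  apply: ge0_subset_integral => //.
  - by apply/measurable_EFinP; exact: measurable_funTS meas.
  - by move=> t _; rewrite lee_fin mulr_ge0 ?powR_ge0 ?expR_ge0.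
  - by move=> t; rewrite /= !in_itv/= andbT => /andP[t1 _]; exact: lt_le_trans t1.
apply: (@lt_le_trans _ _ (\int[lebesgue_measure]_(t in `[1%R, 2%R]) (cst (expR (- 2))%:E t))%E).
  rewrite integral_cst//= lebesgue_measure_itv/= lte_fin ltr1n -EFinD -EFinM lte_fin.
  by rewrite mulr_gt0 ?expR_gt0//; lra.
apply: ge0_le_integral => //.
- by move=> t _; rewrite lee_fin expR_ge0.
- by apply/measurable_EFinP; exact: measurable_funTS meas.
- move=> t; rewrite /= in_itv/= => /andP[t1 t2]; rewrite lee_fin.
  rewrite -[leLHS]mul1r ler_pM ?expR_ge0 ?ler_expR ?lerN2//.
  have -> : 1 = t `^ 0 by rewrite powRr0.
  exact: ler_powR.
Qed.

(** Positivity is not automatic: Gamma and the series are values of total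
    operators, meaningful because the integral and the series converge. *)
Lemma gamma_s_gt0 {R : realType} (p : R) : 1 < p -> 0 < gamma_s p.
Proof.
move=> p1; rewrite /gamma_s -/(odd_zeta_term p).
rewrite mulr_gt0 ?mulr_gt0 ?Gamma_gt0 ?(ltW (lt_trans ltr01 p1))//.
apply: (@lt_le_trans _ _ (series (odd_zeta_term p) 1)).
  by rewrite /series/= big_nat1 /odd_zeta_term mulr0 addr0 powR1 invr1.
apply: nondecreasing_cvgn_le; last exact: cvg_odd_zeta.
by apply: nondecreasing_series => k _ _; exact: odd_zeta_term_ge0.
Qed.

Lemma ge0_integral_dilate {R : realType} (f : R -> \bar R) (r c : R) : 0 < r ->
  measurable_fun [set: R] f -> (forall x, 0 <= f x)%E ->
  (\int[lebesgue_measure]_x f ((x - c) / r)%R =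
   r%:E * \int[lebesgue_measure]_x f x)%E.
Proof.
move=> r0 mf f0; have ri0 : r^-1 != 0 by rewrite invr_eq0 gt_eqF.
rewrite (ge0_integral_affine (- c / r) ri0 mf f0) muleA -EFinM.
rewrite gtr0_norm ?invr_gt0// mulfV ?gt_eqF// mul1e.
by apply: eq_integral => x _; congr f; rewrite mulrBl mulNr mulrC.
Qed.

Definition rescale {R : realType} (A r c : R) (v : R -> R) (x : R) : R :=
  A * v ((x - c) / r).

(** The measure |x - y|^-2 dx dy is invariant under simultaneous dilations and
    translations of x and y. *)
Lemma rescale_gagliardo {R : realType} (p A r c : R) (v : R -> R) :
  0 <= A -> 0 < r -> measurable_fun [set: R] v ->
  (\int[lebesgue_measure]_y \int[lebesgue_measure]_x
     (`|rescale A r c v x - rescale A r c v y| `^ p / `|x - y| ^+ 2)%:E =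
  (A `^ p)%:E * \int[lebesgue_measure]_y \int[lebesgue_measure]_x
     (`|v x - v y| `^ p / `|x - y| ^+ 2)%:E)%E.
Proof.
move=> A0 r0 mv.
pose kr (w : R * R) := `|v w.2 - v w.1| `^ p / `|w.2 - w.1| ^+ 2.
have mkr : measurable_fun [set: R * R] kr.
  apply: measurable_fun_div.
    apply: measurable_fun_powR_cst; apply: measurable_fun_normr.
    by apply: measurable_funB; exact: (measurableT_comp mv).
  by apply: measurable_funX; apply: measurable_fun_normr; exact: measurable_funB.
have mEkr : measurable_fun [set: R * R] (EFin \o kr) by exact/measurable_EFinP.
have kr0 w : 0 <= kr w by rewrite divr_ge0 ?powR_ge0.
have mkr2 a : measurable_fun [set: R] (fun b => (kr (a, b))%:E).
  by apply/measurable_EFinP; exact: (measurable_fun_pair2 a mkr).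
pose phi x : R := (x - c) / r.
have ptw x y : `|rescale A r c v x - rescale A r c v y| `^ p / `|x - y| ^+ 2 =
    (A `^ p / r ^+ 2) * kr (phi y, phi x).
  rewrite /rescale -mulrBr normrM powRM// (ger0_norm A0) /kr/=.
  have -> : phi x - phi y = (x - y) / r by rewrite /phi -mulrBl; congr (_ / _); ring.
  rewrite normrM normfV (gtr0_norm r0) exprMn exprVn.
  rewrite (invfM (`|x - y| ^+ 2)) invrK -/(phi x) -/(phi y).
  move: (A `^ p) (`|v (phi x) - v (phi y)| `^ p) (`|x - y| ^+ 2)^-1 => P Q X.
  by field; rewrite gt_eqF//.
have c0 : 0 <= A `^ p / r ^+ 2 by rewrite divr_ge0 ?powR_ge0 ?exprn_ge0 ?(ltW r0).
pose g y := (\int[lebesgue_measure]_x (kr (y, x))%:E)%E.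
have mg : measurable_fun [set: R] g.
  by apply: (@measurable_fun_fubini_tonelli_F _ _ _ _ _ lebesgue_measure (EFin \o kr)) => // w;
    rewrite lee_fin.
have g0 y : (0 <= g y)%E by apply: integral_ge0 => x _; rewrite lee_fin.
have mphi : measurable_fun [set: R] phi.
  by apply: measurable_funM => //; exact: measurable_funB.
transitivity (\int[lebesgue_measure]_y
  ((A `^ p / r ^+ 2)%:E * (r%:E * g (phi y))))%E.
  apply: eq_integral => y _; under eq_integral do rewrite ptw EFinM.
  rewrite ge0_integralZl_EFin; first last.
  - exact: c0.
  - exact: (measurableT_comp (mkr2 _) mphi).
  - by move=> x _; rewrite lee_fin.
  - exact: measurableT.
  congr (_ * _)%E.
  have k0 x : (0 <= (kr (phi y, x))%:E)%E by rewrite lee_fin.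
  exact: (ge0_integral_dilate (f := fun x => (kr (phi y, x))%:E) c r0 (mkr2 _) k0).
rewrite ge0_integralZl_EFin; first last.
- exact: c0.
- by apply: measurable_funeM; exact: (measurableT_comp mg mphi).
- by move=> y _; rewrite mule_ge0// lee_fin ltW.
- exact: measurableT.
rewrite ge0_integralZl_EFin; first last.
- exact: ltW.
- exact: (measurableT_comp mg mphi).
- by move=> y _.
- exact: measurableT.
rewrite (ge0_integral_dilate (f := g) c r0 mg)//.
rewrite !muleA -!EFinM; congr (_%:E * _)%E.
by field; rewrite gt_eqF.
Qed.

Lemma gagliardo_powR {R : realType} (p : R) (u : R -> R) : p != 0 ->
  (gagliardo p u `^ p = \int[lebesgue_measure]_y \int[lebesgue_measure]_x
      (`|u x - u y| `^ p / `|x - y| ^+ 2)%:E)%E.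
Proof.
move=> p0; rewrite /gagliardo -poweRrM mulVf// poweRe1//.
by apply: integral_ge0 => y _; apply: integral_ge0 => x _;
  rewrite lee_fin divr_ge0 ?powR_ge0.
Qed.

Lemma sobolev_norm_powR {R : realType} (p : R) (u : R -> R) : p != 0 ->
  sobolev_norm p u = ((\int[lebesgue_measure]_x (`|u x| `^ p)%:E +
    \int[lebesgue_measure]_y \int[lebesgue_measure]_x
      (`|u x - u y| `^ p / `|x - y| ^+ 2)%:E) `^ p^-1)%E.
Proof.
by move=> p0; rewrite /sobolev_norm gagliardo_powR// powR_Lnorm.
Qed.

(** * Functions concentrating at a point *)

(** Compare with the next term of the exponential series. *)
Lemma expR_coeff_le {R : realType} (k : nat) (t : R) : 0 < t ->
  t ^+ k / k`!%:R <= k.+1%:R / t * expR t.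
Proof.
move=> t0; have := expR_ge1Dxn k (ltW t0) => h.
have {}h : t ^+ k.+1 / k.+1`!%:R <= expR t by apply: le_trans h; rewrite lerDr.
have -> : t ^+ k / k`!%:R = k.+1%:R / t * (t ^+ k.+1 / k.+1`!%:R).
  have F : k`!%:R != 0 :> R by rewrite pnatr_eq0 -lt0n fact_gt0.
  have K : k.+1%:R != 0 :> R by rewrite pnatr_eq0.
  rewrite factS natrM exprS; move: (k`!%:R) (k.+1%:R) (t ^+ k) F K => x y z x0 y0.
  by field; rewrite x0 y0 gt_eqF.
by rewrite ler_wpM2l// divr_ge0 ?(ltW t0).
Qed.

Lemma Phi_ge0 {R : realType} (p t : R) : 0 <= t -> 0 <= Phi p t.
Proof.
move=> t0; rewrite /Phi subr_ge0.
have := nondecreasing_cvgn_le (u_ := series (exp_coeff t)) _ (is_cvg_series_exp_coeff t).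
apply; apply: nondecreasing_series => k _ _.
by rewrite /exp_coeff/= divr_ge0 ?exprn_ge0.
Qed.

Lemma Phi_ge_half_expR {R : realType} (p : R) :
  exists T : R, forall t, T <= t -> expR t / 2 <= Phi p t.
Proof.
pose m := (`|Num.ceil (p - 2)|%N).+1.
exists (2 * m%:R * m%:R) => t Tt.
have m0 : 0 < m%:R :> R by rewrite ltr0n.
have t0 : 0 < t by apply: lt_le_trans Tt; rewrite !mulr_gt0.
have bnd : \sum_(0 <= k < m) t ^+ k / k`!%:R <= \sum_(0 <= k < m) (m%:R / t * expR t).
  rewrite !big_mkord; apply: ler_sum => k _.
  apply: (le_trans (expR_coeff_le k t0)); rewrite ler_wpM2r ?expR_ge0//.
  by rewrite ler_pM2r ?invr_gt0// ler_nat.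
rewrite sumr_const_nat subn0 -mulr_natl in bnd.
have h : m%:R * (m%:R / t * expR t) <= expR t / 2.
  have -> : m%:R * (m%:R / t * expR t) = (m%:R * m%:R / t) * expR t by ring.
  rewrite [leRHS]mulrC ler_pM2r ?expR_gt0// ler_pdivrMr//.
  by rewrite -ler_pdivrMl ?invr_gt0// invrK; lra.
by rewrite /Phi -/m; lra.
Qed.

(** With g = gamma_s and q = s / (1 - s), the right-hand side is
    L (1 + C / (g L))^-q, because alpha_star = g^q and 1 / (1 - s) = 1 + q; Bernoulli's
    inequality gives a loss bounded independently of L. *)
Lemma alpha_star_exponent {R : realType} (s p C L : R) : 0 < s -> s < 1 ->
  s * p = 1 -> 0 < gamma_s p -> 0 <= C -> 0 < L ->
  L - s / (1 - s) * C / gamma_s p <=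
  alpha_star s p * (((gamma_s p * L + C) `^ p^-1)^-1 * L) `^ (1 - s)^-1.
Proof.
move=> s0 s1 sp g0 C0 L0; rewrite /alpha_star; set q := s / (1 - s).
move: (gamma_s p) g0 => g g0; set Y := g * L + C.
have s10 : 0 < 1 - s by rewrite subr_gt0.
have q0 : 0 < q by rewrite divr_gt0.
have sE : p^-1 = s.
  have p0 : p != 0 by apply: contra_eq_neq sp => ->; rewrite mulr0 eq_sym oner_eq0.
  by rewrite -[LHS]mul1r -sp mulfK.
have gL0 : 0 < g * L by rewrite mulr_gt0.
have Y0 : 0 < Y by rewrite ltr_wpDr.
have e1 : (1 - s)^-1 = 1 + q by rewrite /q; field; rewrite gt_eqF.
have e2 : s * (1 - s)^-1 = q by [].
rewrite sE powRM ?invr_ge0 ?powR_ge0 ?(ltW L0)// -powRN -powRrM mulNr e2 e1.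
rewrite powRD ?(gt_eqF L0) ?implybT// powRr1 ?(ltW L0)// powRN.
have -> : g `^ q * ((Y `^ q)^-1 * (L * L `^ q)) = L * ((g * L) / Y) `^ q.
  rewrite powRM ?(ltW gL0) ?invr_ge0 ?(ltW Y0)// powRM ?(ltW g0) ?(ltW L0)//.
  have -> : Y^-1 `^ q = (Y `^ q)^-1.
    by rewrite -(powR_inv1 (ltW Y0)) -powRrM mulN1r powRN.
  by ring.
have XY0 : 0 < g * L / Y by rewrite divr_gt0.
have pw : 1 - q * (C / (g * L)) <= (g * L / Y) `^ q.
  rewrite /powR gt_eqF//; apply: le_trans (expR_ge1Dx _).
  rewrite lerD2l -mulrN ler_pM2l// lerNl -lnV ?posrE//.
  have -> : (g * L / Y)^-1 = 1 + C / (g * L).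
    by rewrite invf_div /Y mulrDl mulfV ?gt_eqF.
  apply: le_ln1Dx; apply: (@lt_le_trans _ _ 0); first by rewrite ltrN10.
  by rewrite divr_ge0 ?(ltW gL0).
have -> : L - q * C / g = L * (1 - q * (C / (g * L))).
  by field; rewrite !gt_eqF.
by rewrite ler_pM2l.
Qed.

Lemma Cinfty_c_rescale_moser {R : realType} (A N r c a b : R) : 0 < r ->
  a < c - r -> c + r < b -> Cinfty_c `]a, b[ (rescale A r c (moser N)).
Proof.
move=> r0 ac cb; split.
  move=> k x; apply: (CkP (U := [set: R])) => // n; apply: CkZ; first exact: openT.
  have aff : Ck n [set: R] (fun x => (x - c) / r).
    apply: (Ck_ext openT _ (CkZ r^-1 openT (CkD openT (Ck_id n openT)
      (Ck_cst n (- c) openT)))) => y _ /=.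
    by rewrite mulrC.
  exact: (Ck_comp openT openT _ (Ck_moser n N) aff).
have sub : closure [set x | rescale A r c (moser N) x != 0] `<=` `[c - r, c + r].
  have cl : closed (`[c - r, c + r]%classic : set R) by exact: interval_closed.
  rewrite [X in _ `<=` X]((closure_id _).1 cl); apply: closureS => x /=.
  apply: contra_neqT => xr; rewrite /rescale moser_eq0 ?mulr0//.
  rewrite normrM normfV (gtr0_norm r0) ler_pdivlMr// mul1r.
  move: xr; rewrite in_itv/= negb_and -!ltNge => /orP[h|h].
    by rewrite ltr0_norm; lra.
  by rewrite gtr0_norm; lra.
split.
  apply: subclosed_compact sub; first exact: closed_closure.
  exact: segment_compact.
apply: subset_trans sub _ => x /=; rewrite !in_itv/= => /andP[h1 h2].
by rewrite (lt_le_trans ac h1) (le_lt_trans h2 cb).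
Qed.

Lemma measurable_affinity {R : realType} (r c : R) :
  measurable_fun [set: R] (fun x => (x - c) / r).
Proof. by apply: measurable_funM => //; exact: measurable_funB. Qed.

Lemma measurable_rescale {R : realType} (A r c : R) (v : R -> R) :
  measurable_fun [set: R] v -> measurable_fun [set: R] (rescale A r c v).
Proof.
move=> mv; apply: measurable_funM => //.
exact: (measurableT_comp mv (measurable_affinity r c)).
Qed.

(** The constant kappa is independent of T: the plateau has length
    2 r e^-(N+1), while the exponent there is at least N - 1 - e by
    [alpha_star_exponent] and L >= N - 1, so N cancels. *)
Lemma concentrating_bumps {R : realType} (a b s p : R) : a < b ->
  0 < s -> s < 1 -> 1 < p -> s * p = 1 ->
  exists2 kappa : R, 0 < kappa & forall T : R, exists (u : R -> R) (M l h : R),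
    [/\ Cinfty_c `]a, b[ u, measurable_fun [set: R] u, sobolev p u,
        (gagliardo p u <= 1)%E & (sobolev_norm p u <= 1)%E] /\
    [/\ a < l, l < h, h < b & forall x, l <= x <= h -> u x = M] /\
    [/\ 0 <= M, T <= M, T <= alpha_star s p * M `^ (1 - s)^-1 &
        kappa <= (h - l) * expR (alpha_star s p * M `^ (1 - s)^-1)].
Proof.
move=> ab s0 s1 p1 sp; have p0 : 0 < p by exact: lt_trans p1.
have pn0 : p != 0 by rewrite gt_eqF.
have g0 := gamma_s_gt0 p1.
pose c := (a + b) / 2; pose r := (b - a) / 4.
have r0 : 0 < r by rewrite /r divr_gt0// subr_gt0.
have ac : a < c - r by rewrite /c /r; lra.
have cb : c + r < b by rewrite /c /r; lra.
pose C := r * profile_Lp_const p.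
have C0 : 0 <= C by rewrite mulr_ge0 ?profile_Lp_const_ge0// ltW.
pose e := s / (1 - s) * C / gamma_s p.
exists (2 * r * expR (- (2 + e))); first by rewrite mulr_gt0 ?expR_gt0// mulr_gt0.
move=> T.
pose T' := Num.max T 0.
(* The second entry makes the exponent exceed both T and the value that it
   would take at T', which forces M >= T. *)
pose N := Num.max 2 (Num.max T (alpha_star s p * T' `^ (1 - s)^-1) + 2 + e).
have N2 : 2 <= N by rewrite le_max lexx.
have NT : Num.max T (alpha_star s p * T' `^ (1 - s)^-1) + 2 + e <= N.
  by rewrite le_max lexx orbT.
clearbody N.
have N0 : 0 <= N by exact: le_trans N2.
have LN := softpos_ge N.
have L0 : 0 < softpos N by apply: lt_le_trans LN; lra.
pose v := moser N; pose L := softpos N; pose Y := gamma_s p * L + C.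
have Y0 : 0 < Y by rewrite /Y ltr_wpDr// mulr_gt0.
pose A := (Y `^ p^-1)^-1.
have A0 : 0 < A by rewrite invr_gt0 powR_gt0.
have Ap : A `^ p = Y^-1.
  rewrite /A -powRN -powRrM mulNr mulVf// powRN powRr1//; exact: ltW.
have lp := moser_profile N0; have mv := profile_measurable lp.
pose u := rescale A r c v.
have GG : (\int[lebesgue_measure]_y \int[lebesgue_measure]_x
      (`|u x - u y| `^ p / `|x - y| ^+ 2)%:E <= (Y^-1 * (gamma_s p * L))%:E)%E.
  rewrite (rescale_gagliardo p c (ltW A0) r0 mv) Ap EFinM.
  by apply: lee_wpmul2l; [rewrite lee_fin invr_ge0 ltW|exact: profile_gagliardo_le lp].
have mu : measurable_fun [set: R] u.
  exact: measurable_rescale mv.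
have LP : (\int[lebesgue_measure]_x (`|u x| `^ p)%:E <= (Y^-1 * C)%:E)%E.
  have mvp : measurable_fun [set: R] (fun x => (v x `^ p)%:E).
    by apply/measurable_EFinP; exact: measurable_fun_powR_cst.
  have vp0 x : (0 <= (v x `^ p)%:E)%E by rewrite lee_fin powR_ge0.
  have -> : (\int[lebesgue_measure]_x (`|u x| `^ p)%:E =
      \int[lebesgue_measure]_x ((Y^-1)%:E * (v ((x - c) / r)%R `^ p)%:E))%E.
    apply: eq_integral => x _; rewrite -EFinM /u /rescale ger0_norm ?mulr_ge0 ?(ltW A0) ?(profile_ge0 lp)//.
    by rewrite powRM ?(ltW A0) ?(profile_ge0 lp)// Ap.
  rewrite ge0_integralZl_EFin; first last.
  - by rewrite invr_ge0 ltW.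
  - exact: (measurableT_comp mvp (measurable_affinity r c)).
  - by move=> x _.
  - exact: measurableT.
  rewrite (ge0_integral_dilate c r0 mvp vp0).
  have -> : (Y^-1 * C)%:E = ((Y^-1)%:E * (r%:E * (profile_Lp_const p)%:E))%E.
    by rewrite -!EFinM.
  apply: lee_wpmul2l; first by rewrite lee_fin invr_ge0 ltW.
  apply: lee_wpmul2l; first by rewrite lee_fin ltW.
  exact: profile_Lp_le lp.
have YE : Y^-1 * C + Y^-1 * (gamma_s p * L) = 1.
  by rewrite -mulrDr addrC mulVf// gt_eqF.
have YC0 : 0 <= Y^-1 * C by rewrite mulr_ge0// invr_ge0 ltW.
have pi0 : 0 <= p^-1 by rewrite invr_ge0 ltW.
have root_le1 (x : \bar R) : (0 <= x)%E -> (x <= 1)%E -> (x `^ p^-1 <= 1)%E.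
  move=> x0 x1; rewrite -(poweR1r p^-1).
  apply: gt0_ler_poweR => //.
  - by rewrite in_itv/= x0 leey.
  - by rewrite in_itv/= lee01 leey.
have int0 : (0 <= \int[lebesgue_measure]_x (`|u x| `^ p)%:E)%E.
  by apply: integral_ge0 => x _; rewrite lee_fin powR_ge0.
have dint0 : (0 <= \int[lebesgue_measure]_y \int[lebesgue_measure]_x
      (`|u x - u y| `^ p / `|x - y| ^+ 2)%:E)%E.
  apply: integral_ge0 => y _; apply: integral_ge0 => x _.
  by rewrite lee_fin divr_ge0 ?powR_ge0.
have sn : (sobolev_norm p u <= 1)%E.
  rewrite sobolev_norm_powR//; apply: root_le1; first exact: adde_ge0.
  by apply: (le_trans (leeD LP GG)); rewrite -EFinD YE.
have gn : (gagliardo p u <= 1)%E.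
  apply: root_le1 => //; apply: (le_trans GG).
  by rewrite lee_fin -YE lerDr.
exists u, (A * L), (c - r * expR (- (N + 1))), (c + r * expR (- (N + 1))).
have d0 : 0 < r * expR (- (N + 1)) by rewrite mulr_gt0 ?expR_gt0.
have dr : r * expR (- (N + 1)) <= r.
  by rewrite ger_pMr// expR_le1; lra.
have E := alpha_star_exponent s0 s1 sp g0 C0 L0.
rewrite -/L -/Y -/A -/e in E.
have M0 : 0 <= A * L by rewrite mulr_ge0// ltW.
split; [split => //|split; [split|split => //]].
- exact: Cinfty_c_rescale_moser.
- split; last by apply: le_lt_trans gn _; exact: ltry.
  apply/andP; split; first by rewrite inE.
  rewrite inE /= /finite_norm; apply: (@lty_poweRy _ _ p) => //.
  by rewrite poweR_Lnorm//; apply: le_lt_trans LP _; exact: ltry.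
- by lra.
- by lra.
- by lra.
- move=> x /andP[h1 h2]; rewrite /u /rescale /v moser_plateau//.
  rewrite normrM normfV (gtr0_norm r0) ler_pdivrMr// mulrC ler_norml.
  by apply/andP; split; lra.
- rewrite leNgt; apply/negP => MT.
  have T'E : T' = T by rewrite /T' max_l// (le_trans M0)// ltW.
  have h1 : (A * L) `^ (1 - s)^-1 <= T `^ (1 - s)^-1.
    apply: ge0_ler_powR; rewrite ?nnegrE ?invr_ge0 ?subr_ge0 ?(ltW s1) ?(ltW MT)//.
    by rewrite (le_trans M0)// ltW.
  have h2 := ler_wpM2l (powR_ge0 (gamma_s p) (s / (1 - s))) h1.
  have h3 : alpha_star s p * T `^ (1 - s)^-1 <=
      Num.max T (alpha_star s p * T' `^ (1 - s)^-1) by rewrite T'E le_max lexx orbT.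
  have := le_trans E (le_trans h2 h3); rewrite /L.
  by move: (Num.max _ _) NT LN => m NT LN; rewrite leNgt => /negP; apply; lra.
- apply: le_trans E; apply: (@le_trans _ _ (N - 1 - e)); last by rewrite /L; lra.
  have : T <= Num.max T (alpha_star s p * T' `^ (1 - s)^-1) by rewrite le_max lexx.
  by lra.
- have -> : c + r * expR (- (N + 1)) - (c - r * expR (- (N + 1))) =
    2 * r * expR (- (N + 1)) by ring.
  have r20 : 0 < 2 * r by rewrite mulr_gt0.
  rewrite -[leRHS]mulrA (ler_pM2l r20) -expRD ler_expR.
  by apply: le_trans (lerD (lexx _) E); rewrite /L; lra.
Qed.

(** * Divergence of the two suprema *)

Lemma ereal_sup_eqy {R : realType} (S : set (\bar R)) :
  (forall B : R, 0 < B -> exists2 x, S x & (B%:E <= x)%E) -> ereal_sup S = +oo%E.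
Proof.
move=> H; apply/eqyP => B /H[x Sx Bx].
by apply: le_trans Bx _; exact: ereal_sup_ubound.
Qed.

Lemma integral_ge_on_itv {R : realType} (D : set R) (F : R -> R) (K l h : R) :
  measurable D -> measurable_fun D F -> (forall x, D x -> 0 <= F x) ->
  `[l, h] `<=` D -> l < h -> 0 <= K -> (forall x, l <= x <= h -> K <= F x) ->
  (((h - l) * K)%:E <= \int[lebesgue_measure]_(x in D) (F x)%:E)%E.
Proof.
move=> mD mF F0 lhD lh K0 KF.
have mFlh : measurable_fun (`[l, h] : set R) (EFin \o F).
  by apply/measurable_EFinP; exact: measurable_funS mF.
apply: (@le_trans _ _ (\int[lebesgue_measure]_(x in `[l, h]) (F x)%:E)%E); last first.
  by apply: ge0_subset_integral => //; exact/measurable_EFinP.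
apply: (@le_trans _ _ (\int[lebesgue_measure]_(x in `[l, h]) (cst K%:E x))%E).
  by rewrite integral_cst//= lebesgue_measure_itv/= lte_fin lh -EFinD -EFinM mulrC.
exact: ge0_le_integral.
Qed.

Lemma measurable_Phi {R : realType} (p : R) : measurable_fun [set: R] (Phi p).
Proof.
apply: measurable_funB; first exact: measurable_expR.
elim: (`|Num.ceil (p - 2)|%N).+1 => [|n IH].
  have -> : (fun t : R => \sum_(0 <= k < 0) t ^+ k / k`!%:R) = cst 0.
    by apply/funext => t; rewrite big_geq.
  exact: measurable_cst.
have -> : (fun t : R => \sum_(0 <= k < n.+1) t ^+ k / k`!%:R) =
    (fun t => \sum_(0 <= k < n) t ^+ k / k`!%:R + t ^+ n / n`!%:R).
  by apply/funext => t; rewrite big_nat_recr.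
apply: measurable_funD; first exact: IH.
by apply: measurable_funM => //; exact: measurable_funX.
Qed.

Lemma sobolev_norm_subrr {R : realType} (p : R) (u : R -> R) : p != 0 ->
  sobolev_norm p (u \- u) = 0%E.
Proof.
move=> p0; rewrite sobolev_norm_powR//.
rewrite integral0_eq; last by move=> x _; rewrite /= subrr normr0 powR0.
rewrite integral0_eq; last first.
  move=> y _; apply: integral0_eq => x _.
  by rewrite /= !subrr normr0 powR0// mul0r.
by rewrite adde0 poweR0r// invr_eq0.
Qed.

Unset Implicit Arguments.

Theorem theorem1p3 (R : realType) (a b : R) (hab : a < b)
    (s p : R) (hs0 : 0 < s) (hs1 : s < 1) (hp : 1 < p) (hsp : s * p = 1)
    (f : R -> R) (hfm : measurable_fun (`[0, +oo[%classic : set R) f)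
    (hf0 : forall t, 0 <= t -> 0 <= f t)
    (hflim : f t @[t --> +oo] --> +oo) :
  ereal_sup [set (\int[lebesgue_measure]_(x in `]a, b[)
        (f `|u x| * expR (alpha_star s p * `|u x| `^ (1 - s)^-1))%:E)%E
      | u in [set u | sobolev0 p `]a, b[ u /\ (gagliardo p u <= 1)%E]]
    = +oo%E
  /\
  ereal_sup [set (\int[lebesgue_measure]_x
        (f `|u x| * Phi p (alpha_star s p * `|u x| `^ (1 - s)^-1))%:E)%E
      | u in [set u | sobolev p u /\ (sobolev_norm p u <= 1)%E]]
    = +oo%E.
Proof.
have p0 : 0 < p by exact: lt_trans hp.
have pn0 : p != 0 by rewrite gt_eqF.
have al0 : 0 <= alpha_star s p by exact: powR_ge0.
have [kappa k0 bumps] := concentrating_bumps hab hs0 hs1 hp hsp.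
have mfu (u : R -> R) : measurable_fun [set: R] u ->
    measurable_fun [set: R] (fun x => f `|u x|).
  move=> mu; apply: (measurable_comp (F := `[0, +oo[%classic : set R) _ _ hfm
    (measurable_fun_normr mu)) => //.
  by move=> _ [x _ <-]; rewrite /= in_itv/= normr_ge0.
pose t_ (u : R -> R) x := alpha_star s p * `|u x| `^ (1 - s)^-1.
have mt (u : R -> R) : measurable_fun [set: R] u -> measurable_fun [set: R] (t_ u).
  by move=> mu; apply: measurable_funM => //; apply: measurable_fun_powR_cst;
    exact: measurable_fun_normr.
have t0 (u : R -> R) x : 0 <= t_ u x by rewrite mulr_ge0 ?powR_ge0.
have flarge B : exists T : R, forall t, T < t -> B <= f t.
  have /cvgryPge/(_ B)[T [_ HT]] := hflim.
  by exists T.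
split; apply: ereal_sup_eqy => B B0.
- have [T HT] := flarge (B / kappa).
  have [u [M [l [h [[cu mu su gu _] [[al lh hb uM] [M0 TM _ kM]]]]]]] := bumps (T + 1).
  have fM : B / kappa <= f M by apply: HT; lra.
  exists (\int[lebesgue_measure]_(x in `]a, b[) (f `|u x| * expR (t_ u x))%:E)%E.
    exists u => //; split => //; split => // e e0; exists u => //.
    (* The bump is a test function, so it approximates itself. *)
    by rewrite sobolev_norm_subrr.
  have KE : B <= (h - l) * (f M * expR (alpha_star s p * M `^ (1 - s)^-1)).
    rewrite mulrCA; apply: le_trans (ler_wpM2l _ kM); last exact: hf0.
    by rewrite -ler_pdivrMr.
  rewrite -lee_fin in KE; apply: (le_trans KE).
  apply: integral_ge_on_itv.
  + exact: measurable_itv.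
  + apply: measurable_funTS; apply: measurable_funM; first exact: mfu.
    by apply: measurableT_comp; [exact: measurable_expR|exact: mt].
  + by move=> x _; rewrite mulr_ge0 ?expR_ge0 ?hf0.
  + move=> x; rewrite /= !in_itv/= => /andP[lx xh].
    by rewrite (lt_le_trans al lx) (le_lt_trans xh hb).
  + exact: lh.
  + by rewrite mulr_ge0 ?expR_ge0 ?hf0.
  + by move=> x /uM; rewrite /t_ => ->; rewrite ger0_norm.
- have [T HT] := flarge (2 * (B / kappa)).
  have [T2 HT2] := Phi_ge_half_expR p.
  have [u [M [l [h [[cu mu su _ nu] [[al lh hb uM] [M0 TM T2M kM]]]]]]] :=
    bumps (Num.max (T + 1) T2).
  have fM : 2 * (B / kappa) <= f M.
    by apply: HT; move: TM; rewrite ge_max => /andP[+ _]; lra.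
  have {}T2M : T2 <= alpha_star s p * M `^ (1 - s)^-1.
    by move: T2M; rewrite ge_max => /andP[].
  exists (\int[lebesgue_measure]_x (f `|u x| * Phi p (t_ u x))%:E)%E.
    by exists u.
  set E := expR _ in kM.
  have KE : B <= (h - l) * (f M * (E / 2)).
    have -> : (h - l) * (f M * (E / 2)) = (f M / 2) * ((h - l) * E) by field.
    apply: le_trans (ler_wpM2l _ kM); last by rewrite divr_ge0// hf0.
    by rewrite -ler_pdivrMr//; lra.
  rewrite -lee_fin in KE; apply: (le_trans KE).
  apply: integral_ge_on_itv.
  + exact: measurableT.
  + apply: measurable_funM; first exact: mfu.
    by apply: (measurableT_comp (measurable_Phi p)); exact: mt.
  + by move=> x _; rewrite mulr_ge0 ?Phi_ge0 ?hf0.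
  + exact: subsetT.
  + exact: lh.
  + by rewrite mulr_ge0 ?divr_ge0 ?expR_ge0 ?hf0.
  + move=> x /uM; rewrite /t_ => ->; rewrite ger0_norm//.
    by rewrite ler_wpM2l ?hf0// HT2.
Qed.
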